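(* Let $F$ be a totally real number field with adele ring $\mathbb{A}$ and ring of integers $\mathcal{O}$, let $\hat{\mathcal{O}}\subset\mathbb{A}_f$ be the profinite completion of $\mathcal{O}$, let $\omega$ be a unitary Hecke character of $\mathbb{A}^\times/F^\times$, and let $\varphi\in\mathcal{S}(\mathbb{A}^2)$ be a Schwartz-Bruhat function. Then there exists a subgroup $K\subset\mathrm{GL}_2(\hat{\mathcal{O}})$ of finite index such that for every $h\in K$ (viewed in $\mathrm{GL}_2(\mathbb{A})$ with identity components at the archimedean places) and every $g\in\mathrm{GL}_2(\mathbb{A})$, $$E^{\rm ana}_{\omega,s}(\varphi)(gh)=E^{\rm ana}_{\omega,s}(\varphi)(g),$$ as an identity between meromorphic functions of $s$.
   Context: $|\cdot|$ is the idelic norm, $\mathbb{A}_f$ the finite adeles. $\mathcal{S}(\mathbb{A}^2)$ is the space of complex-valued Schwartz-Bruhat functions on $\mathbb{A}^2$ (column vectors). For $\Re(s)>1$, $$E^{\rm ana}_{\omega,s}(\varphi)(g)=|\det g|^{-s}\int_{\mathbb{A}^\times/F^\times}\omega(t)|t|^{2s}\,\Theta(\varphi)(t^{-1}g)\,d^\times t,\qquad \Theta(\varphi)(g)=\sum_{v\in F^2\setminus\{0\}}\varphi(g^{-1}v),$$ where an idele $t$ is identified with the scalar matrix $t\cdot 1_2$; this converges absolutely for $\Re(s)>1$, and for other $s$ the notation denotes the meromorphic continuation to $\mathbb{C}$ (which exists). $d^\times t$ is a fixed Haar measure on $\mathbb{A}^\times$, with the quotient measure on $\mathbb{A}^\times/F^\times$.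 *)

(* Defs.v *)
From HB Require Import structures.
From mathcomp Require Import all_boot all_order all_algebra all_field.
From mathcomp Require Import complex generic_quotient ring_quotient.
From mathcomp Require Import ring lra.
From mathcomp Require Import all_classical all_reals all_analysis.
From mathcomp Require Import measurable_realfun.

Set Implicit Arguments.
Unset Strict Implicit.
Unset Printing Implicit Defensive.

Import Order.TTheory GRing.Theory Num.Theory.
Import numFieldNormedType.Exports.

Local Open Scope classical_set_scope.
Local Open Scope ring_scope.
Local Open Scope quotient_scope.

HB.instance Definition _ (R : realType) :=
  NormedModule.copy R[i] (R[i] : numFieldType)^o.

(* Meromorphic functions on the complex plane, as functions with values in the
   Riemann sphere, None being the point at infinity: near each z0, f has a
   Laurent expansion \sum_(k >= 0) a_k (z - z0)^(k - m), and f z0 is the value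
   of this expansion if m = 0, and infinity if m > 0 and a_0 != 0. *)
Definition meromorphic (R : realType) (f : R[i] -> option R[i]) : Prop :=
  forall z0 : R[i], exists (m : nat) (a : nat -> R[i]) (S : R[i] -> R[i]) (r : R),
    [/\ 0 < r,
        forall w : R[i], `|w| < (r%:C)%C ->
          series (fun k => a k * w ^+ k) @ \oo --> S w,
        forall z, 0 < `|z - z0| < (r%:C)%C ->
          f z = Some ((z - z0) ^- m * S (z - z0)),
        m = 0%N -> f z0 = Some (a 0%N)
      & (0 < m)%N -> a 0%N != 0 /\ f z0 = None].

(* A finite place of the number field F is given by its normalised absolute
   value: it is non-archimedean, its residue field is finite, of cardinality q,
   and the absolute value of a uniformiser, i.e. the largest value smaller
   than 1, is 1/q (this excludes the trivial absolute value).  When F is a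
   number field these are the P-adic absolute values x |-> N(P)^(- ord_P x),
   one for each maximal ideal P of the ring of integers. *)
Record finPlace (R : realType) (F : fieldType) := FinPlace {
  pabs :> F -> R ;
  pabs_ge0 : forall x, 0 <= pabs x ;
  pabs_eq0 : forall x, (pabs x == 0) = (x == 0) ;
  pabsM : forall x y, pabs (x * y) = pabs x * pabs y ;
  pabs_ultra : forall x y, pabs (x + y) <= Num.max (pabs x) (pabs y) ;
  pabs_normalised : exists (q : nat) (r : 'I_q -> F),
    [/\ forall i, pabs (r i) <= 1,
        forall x, pabs x <= 1 -> exists! i, pabs (x - r i) < 1,
        forall x, pabs x < 1 -> pabs x <= q%:R^-1
      & exists x, pabs x = q%:R^-1] }.

HB.instance Definition _ (R : realType) (F : fieldType) :=
  gen_eqMixin (finPlace R F).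
HB.instance Definition _ (R : realType) (F : fieldType) :=
  gen_choiceMixin (finPlace R F).

Section Completion.
Variables (R : realType) (F : fieldType) (v : finPlace R F).
Implicit Types (x y : F) (u w : nat -> F) (e : R).

Lemma pabs0 : v 0 = 0. Proof. by apply/eqP; rewrite pabs_eq0. Qed.

Lemma pabs1 : v 1 = 1.
Proof.
have v1 : v 1 != 0 by rewrite pabs_eq0 oner_eq0.
by apply: (mulfI v1); rewrite -pabsM !mulr1.
Qed.

Lemma pabsN x : v (- x) = v x.
Proof.
have : v (-1) ^+ 2 = 1 by rewrite expr2 -pabsM mulrNN mulr1 pabs1.
move=> /eqP; rewrite sqrf_eq1 => /orP[/eqP v1|/eqP v1].
  by rewrite -mulN1r pabsM v1 mul1r.
by have := pabs_ge0 v (-1); rewrite v1 oppr_ge0 ler10.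
Qed.

Lemma pabsB_ultra x y : v (x - y) <= Num.max (v x) (v y).
Proof. by rewrite -(pabsN y) pabs_ultra. Qed.

Lemma pabs_distC x y : v (x - y) = v (y - x).
Proof. by rewrite -pabsN opprB. Qed.

Lemma pabs_triangle x y : v (x + y) <= v x + v y.
Proof.
by apply: le_trans (pabs_ultra v x y) _; rewrite ge_max lerDl lerDr !pabs_ge0.
Qed.

Lemma pabs_dist x y : `|v x - v y| <= v (x - y).
Proof.
rewrite ler_norml; apply/andP; split.
  have := pabs_triangle (y - x) x; rewrite subrK (pabs_distC y); lra.
have := pabs_triangle (x - y) y; rewrite subrK; lra.
Qed.

Lemma pabsV x : v x^-1 = (v x)^-1.
Proof.
have [->|x0] := eqVneq x 0; first by rewrite !(invr0, pabs0).
apply: (@mulfI _ (v x)); first by rewrite pabs_eq0.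
by rewrite -pabsM !mulfV ?pabs1// pabs_eq0.
Qed.

Definition cauchy_pred : {pred nat -> F} := fun u =>
  `[< forall e, 0 < e -> exists N, forall m n, (N <= m)%N -> (N <= n)%N ->
        v (u m - u n) < e >].

Definition null_pred : {pred nat -> F} := fun u =>
  `[< forall e, 0 < e -> exists N, forall n, (N <= n)%N -> v (u n) < e >].

Lemma cauchy_bounded u : u \in cauchy_pred ->
  exists2 B : R, 0 < B & exists N, forall n, (N <= n)%N -> v (u n) <= B.
Proof.
move=> /asboolP/(_ _ ltr01)[N uN]; exists (1 + v (u N)).
  by rewrite ltr_wpDr// pabs_ge0.
exists N => n Nn; rewrite -(subrK (u N) (u n)).
by apply: le_trans (pabs_triangle _ _) _; rewrite lerD2r ltW// uN.
Qed.

Lemma cauchy_subring : subring_closed cauchy_pred.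
Proof.
split.
- by apply/asboolP => e e0; exists 0%N => m n _ _; rewrite /= subrr pabs0.
- move=> u w /asboolP uC /asboolP wC; apply/asboolP => e e0.
  have [N uN] := uC _ e0; have [M wM] := wC _ e0; exists (maxn N M) => m n.
  rewrite !geq_max => /andP[Nm Mm] /andP[Nn Mn].
  have -> : (u - w) m - (u - w) n = (u m - u n) - (w m - w n).
    by rewrite /= !fctE; ring.
  by apply: le_lt_trans (pabsB_ultra _ _) _; rewrite gt_max uN// wM.
- move=> u w uC wC; apply/asboolP => e e0.
  have [B B0 [Nb uB]] := cauchy_bounded uC.
  have [D D0 [Nd wD]] := cauchy_bounded wC.
  move/asboolP : uC => /(_ _ (divr_gt0 e0 D0))[N uN].
  move/asboolP : wC => /(_ _ (divr_gt0 e0 B0))[M wM].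
  exists (maxn (maxn Nb Nd) (maxn N M)) => m n.
  rewrite !geq_max => /andP[/andP[bm dm] /andP[Nm Mm]].
  move=> /andP[/andP[bn dn] /andP[Nn Mn]].
  have -> : (u * w) m - (u * w) n = (u m - u n) * w m + u n * (w m - w n).
    by rewrite /= !fctE; ring.
  apply: le_lt_trans (pabs_ultra _ _ _) _; rewrite gt_max !pabsM.
  apply/andP; split.
    apply: le_lt_trans (ler_wpM2l (pabs_ge0 _ _) (wD _ dm)) _.
    by rewrite -ltr_pdivlMr// uN.
  apply: le_lt_trans (ler_wpM2r (pabs_ge0 _ _) (uB _ bn)) _.
  by rewrite mulrC -ltr_pdivlMr// wM.
Qed.

HB.instance Definition _ :=
  GRing.isSubringClosed.Build (nat -> F) cauchy_pred cauchy_subring.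

Record cauchySeq := CauchySeq { cseq :> nat -> F ; _ : cseq \in cauchy_pred }.
HB.instance Definition _ := [isSub for cseq].
HB.instance Definition _ := [Choice of cauchySeq by <:].
HB.instance Definition _ := [SubChoice_isSubComNzRing of cauchySeq by <:].

Lemma cseqP (u : cauchySeq) : (u : nat -> F) \in cauchy_pred.
Proof. by case: u. Qed.

Definition null_ideal : {pred cauchySeq} :=
  fun u : cauchySeq => (u : nat -> F) \in null_pred.

Lemma null_idealr_closed : idealr_closed null_ideal.
Proof.
split.
- by apply/asboolP => e e0; exists 0%N => n _; rewrite /= pabs0.
- apply/negP => /asboolP/(_ _ ltr01)[N /(_ _ (leqnn N))].
  by rewrite /= pabs1 ltxx.
- move=> a u w /asboolP u0 /asboolP w0; apply/asboolP => e e0.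
  have [B B0 [Nb aB]] := cauchy_bounded (cseqP a).
  have [N uN] := u0 _ (divr_gt0 e0 B0); have [M wM] := w0 _ e0.
  exists (maxn Nb (maxn N M)) => n; rewrite !geq_max => /and3P[bn Nn Mn].
  apply: le_lt_trans (pabs_ultra _ _ _) _; rewrite gt_max wM// andbT pabsM.
  apply: le_lt_trans (ler_wpM2r (pabs_ge0 _ _) (aB _ bn)) _.
  by rewrite mulrC -ltr_pdivlMr// uN.
Qed.

HB.instance Definition _ := isIdealr.Build cauchySeq null_ideal null_idealr_closed.

Definition completion := {ideal_quot null_ideal}.
HB.instance Definition _ := GRing.ComNzRing.on completion.
HB.instance Definition _ := EqQuotient.on completion.

Lemma completion_inv (a : completion) :
  exists b : completion, (a != 0 -> b * a = 1) /\ (a = 0 -> b = 0).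
Proof.
have [->|a0] := eqVneq a 0; first by exists 0.
suff [b ba] : exists b, b * a = 1 by exists b; split => // /eqP; rewrite (negbTE a0).
have : repr a \notin null_ideal.
  apply: contra a0 => a0; apply/eqP; rewrite -[a]reprK.
  by apply/eqP; rewrite -(subr0 (repr a)) in a0; rewrite Quotient.idealrBE in a0;
     move: a0; rewrite (_ : \pi_completion 0 = 0)//; rewrite !piE.
set u := repr a => nu.
have [e e0 [N ue]] : exists2 e, 0 < e & exists N, forall n, (N <= n)%N -> e <= v (u n).
  apply: contrapT => H; move/negP : nu; apply; apply/asboolP => e e0.
  have /asboolP/(_ _ e0)[N uN] := cseqP u.
  have [n Nn un] : exists2 n, (N <= n)%N & v (u n) < e.
    apply: contrapT => H'; apply: H; exists e => //; exists N => n Nn.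
    by rewrite leNgt; apply/negP => une; apply: H'; exists n.
  exists N => m Nm; rewrite -(subrK (u n) (u m)).
  by apply: le_lt_trans (pabs_ultra _ _ _) _; rewrite gt_max uN.
have wC : (fun n => (u n)^-1) \in cauchy_pred.
  apply/asboolP => d d0.
  have /asboolP/(_ _ (mulr_gt0 d0 (mulr_gt0 e0 e0)))[M uM] := cseqP u.
  exists (maxn N M) => m n; rewrite !geq_max => /andP[Nm Mm] /andP[Nn Mn].
  have um := ue _ Nm; have un := ue _ Nn.
  have um0 : u m != 0 by rewrite -(pabs_eq0 v) gt_eqF// (lt_le_trans e0).
  have un0 : u n != 0 by rewrite -(pabs_eq0 v) gt_eqF// (lt_le_trans e0).
  have -> : (u m)^-1 - (u n)^-1 = (u n - u m) * ((u m)^-1 * (u n)^-1).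
    by rewrite mulrBl mulrCA mulfV// mulr1 mulrA mulfV// mul1r.
  have vv : 0 < v (u m) * v (u n) by rewrite mulr_gt0// (lt_le_trans e0).
  rewrite !pabsM !pabsV -invfM ltr_pdivrMr//.
  apply: lt_le_trans (uM _ _ Mn Mm) _.
  by apply: ler_wpM2l; [exact: ltW | apply: ler_pM => //; exact: ltW].
exists (\pi_completion (CauchySeq wC)); rewrite -[a]reprK -/u.
rewrite (_ : 1 = \pi_completion 1); last by rewrite !piE.
rewrite -[_ * _]/(Quotient.mul _ _) -Quotient.pi_mul.
apply/eqP; rewrite -Quotient.idealrBE; apply/asboolP => d d0; exists N => n Nn.
have un0 : u n != 0 by rewrite -(pabs_eq0 v) gt_eqF// (lt_le_trans e0 (ue _ Nn)).
by rewrite /= !fctE /= mulVf// subrr pabs0.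
Qed.

Definition cinv (a : completion) : completion := projT1 (cid (completion_inv a)).

Lemma cmulVf (a : completion) : a != 0 -> cinv a * a = 1.
Proof. by case: (projT2 (cid (completion_inv a))) => H _ /H. Qed.

Lemma cinv0 : cinv 0 = 0.
Proof. by case: (projT2 (cid (completion_inv 0))) => _ /(_ erefl). Qed.

HB.instance Definition _ := GRing.ComNzRing_isField.Build completion cmulVf cinv0.

Lemma cst_cauchy x : (fun=> x) \in cauchy_pred.
Proof. by apply/asboolP => e e0; exists 0%N => m n _ _; rewrite subrr pabs0. Qed.

Definition cemb x : completion := \pi_completion (CauchySeq (cst_cauchy x)).

Definition cabs (a : completion) : R := limn (fun n => v (repr a n)).

Lemma cauchy_pabs_cvg u : u \in cauchy_pred -> cvgn (fun n => v (u n)).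
Proof.
move=> /asboolP uC; apply/cauchy_cvgP/cauchy_exP => e e0.
have [N uN] := uC _ e0; exists (v (u N)); exists N => //= n Nn.
by rewrite /ball/=; apply: le_lt_trans (pabs_dist _ _) _; exact: uN.
Qed.

Lemma cabs_pi (u : cauchySeq) : cabs (\pi u) = limn (fun n => v (u n)).
Proof.
rewrite /cabs; set w := repr _.
have : w - u \in null_ideal by rewrite Quotient.idealrBE reprK.
move=> /asboolP wu; apply/cvg_lim => //.
have -> : (fun n => v (w n)) = (fun n => v (u n) + (v (w n) - v (u n))).
  by apply/funext => n; rewrite addrC subrK.
rewrite -[X in _ --> X]addr0; apply: cvgD; first exact: cauchy_pabs_cvg (cseqP _).
apply/cvgr0Pnorm_lt => e e0; have [N wuN] := wu _ e0; exists N => //= n Nn.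
by apply: le_lt_trans (pabs_dist _ _) _; exact: wuN.
Qed.

Lemma cabs_emb x : cabs (cemb x) = v x.
Proof. by rewrite cabs_pi; apply: cvg_lim => //; apply: (@cvg_cst R (v x)). Qed.

Lemma pi_addE (u w : cauchySeq) : \pi_completion (u + w) = \pi u + \pi w.
Proof. exact: Quotient.pi_add. Qed.

Lemma pi_mulE (u w : cauchySeq) : \pi_completion (u * w) = \pi u * \pi w.
Proof. exact: Quotient.pi_mul. Qed.

Lemma pi_oppE (u : cauchySeq) : \pi_completion (- u) = - \pi u.
Proof. exact: Quotient.pi_opp. Qed.

Lemma cemb0 : cemb 0 = 0.
Proof.
rewrite (_ : 0 = \pi_completion 0); last by rewrite !piE.
by congr \pi; exact: val_inj.
Qed.

Lemma cemb1 : cemb 1 = 1.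
Proof.
rewrite (_ : 1 = \pi_completion 1); last by rewrite !piE.
by congr \pi; exact: val_inj.
Qed.

Lemma cembM x y : cemb (x * y) = cemb x * cemb y.
Proof. by rewrite -pi_mulE; congr \pi; exact: val_inj. Qed.

Lemma cembB x y : cemb (x - y) = cemb x - cemb y.
Proof. by rewrite -pi_oppE -pi_addE; congr \pi; exact: val_inj. Qed.

HB.instance Definition _ := GRing.isZmodMorphism.Build F completion cemb cembB.
HB.instance Definition _ :=
  GRing.isMonoidMorphism.Build F completion cemb (conj cemb1 cembM).

Lemma cabs0 : cabs 0 = 0.
Proof. by rewrite -cemb0 cabs_emb pabs0. Qed.

Lemma cabs1 : cabs 1 = 1.
Proof. by rewrite -cemb1 cabs_emb pabs1. Qed.

Lemma cabs_ge0 (a : completion) : 0 <= cabs a.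
Proof.
rewrite -[a]reprK cabs_pi; apply: limr_ge; first exact: cauchy_pabs_cvg (cseqP _).
by apply: nearW => n; exact: pabs_ge0.
Qed.

Lemma cabsN (a : completion) : cabs (- a) = cabs a.
Proof.
rewrite -[a]reprK -pi_oppE !cabs_pi.
by congr (limn _); apply/funext => n; rewrite -[LHS]/(v (- _)) pabsN.
Qed.

Lemma cabsM (a b : completion) : cabs (a * b) = cabs a * cabs b.
Proof.
rewrite -[a]reprK -[b]reprK -pi_mulE !cabs_pi.
rewrite -limM; [|exact: cauchy_pabs_cvg (cseqP _)..].
by congr (limn _); apply/funext => n; rewrite -[LHS]/(v (_ * _)) pabsM.
Qed.

Lemma cabs_ultra (a b : completion) :
  cabs (a + b) <= Num.max (cabs a) (cabs b).
Proof.
rewrite -[a]reprK -[b]reprK -pi_addE !cabs_pi.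
set u := repr a; set w := repr b; set B := Num.max _ _.
apply/ler_addgt0Pr => e e0; apply: limr_le.
  exact: cauchy_pabs_cvg (cseqP (u + w)).
have near_lt (z : cauchySeq) : limn (fun n => v (z n)) <= B ->
    \forall n \near \oo, v (z n) < B + e.
  move=> zB; have /cvgrPdist_lt/(_ _ e0) := cauchy_pabs_cvg (cseqP z).
  by apply: filterS => n; rewrite ltr_distlC => /andP[_] /lt_le_trans; apply; rewrite lerD2r.
near=> n; rewrite -[v _]/(v (u n + w n)); apply: le_trans (pabs_ultra _ _ _) _.
rewrite ge_max; apply/andP; split; apply: ltW.
- by near: n; apply: near_lt; rewrite le_max lexx.
- by near: n; apply: near_lt; rewrite le_max lexx orbT.
Unshelve. all: by end_near. Qed.

Definition copen (U : set completion) := forall a, U a ->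
  exists2 e, 0 < e & forall b, cabs (b - a) < e -> U b.

Lemma copenT : copen setT.
Proof. by move=> a _; exists 1. Qed.

Lemma copenI : setI_closed copen.
Proof.
move=> U V Uo Vo a [/Uo[e e0 eU] /Vo[d d0 dV]]; exists (Num.min e d).
  by rewrite lt_min e0.
by move=> b; rewrite lt_min => /andP[/eU ? /dV].
Qed.

Lemma copen_bigcup (I : Type) (U : I -> set completion) :
  (forall i, copen (U i)) -> copen (\bigcup_i U i).
Proof.
move=> Uo a [i _ /Uo[e e0 eU]]; exists e => // b /eU Ub.
by exists i.
Qed.

HB.instance Definition _ :=
  isOpenTopological.Build completion copenT copenI copen_bigcup.

End Completion.

(* The group of units of a ring M, as pairs of an element and its inverse *)
Record units (M : pzRingType) := Units {
  uval :> M ;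
  uinv : M ;
  uvalK : uval * uinv = 1 ;
  uinvK : uinv * uval = 1 }.

Lemma units_inj (M : pzRingType) : injective (@uval M).
Proof.
move=> [x x' xx' x'x] [y y' yy' y'y] /= xy; rewrite -{}xy in yy' y'y *.
have xy' : x' = y' by rewrite -[x']mul1r -y'y -mulrA xx' mulr1.
by rewrite -{}xy' in yy' y'y *; congr Units; exact: Prop_irrelevance.
Qed.

HB.instance Definition _ (M : pzRingType) := gen_eqMixin (units M).
HB.instance Definition _ (M : pzRingType) := gen_choiceMixin (units M).

Section UnitsGroup.
Variable M : pzRingType.
Implicit Types x y z : units M.

Definition unit_one : units M := Units (mulr1 1) (mulr1 1).

Definition unit_inv x : units M := Units (uinvK x) (uvalK x).

Fact unit_mulK x y : (uval x * uval y) * (uinv y * uinv x) = 1.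
Proof. by rewrite mulrA -(mulrA (uval x)) uvalK mulr1 uvalK. Qed.

Fact unit_mulVK x y : (uinv y * uinv x) * (uval x * uval y) = 1.
Proof. by rewrite mulrA -(mulrA (uinv y)) uinvK mulr1 uinvK. Qed.

Definition unit_mul x y : units M := Units (unit_mulK x y) (unit_mulVK x y).

Fact unit_mulA : associative unit_mul.
Proof. by move=> x y z; apply: units_inj; rewrite /= mulrA. Qed.

Fact unit_mul1 : left_id unit_one unit_mul.
Proof. by move=> x; apply: units_inj; rewrite /= mul1r. Qed.

Fact unit_mulr1 : right_id unit_one unit_mul.
Proof. by move=> x; apply: units_inj; rewrite /= mulr1. Qed.

Fact unit_mulV : left_inverse unit_one unit_inv unit_mul.
Proof. by move=> x; apply: units_inj; rewrite /= uinvK. Qed.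

Fact unit_mulrV : right_inverse unit_one unit_inv unit_mul.
Proof. by move=> x; apply: units_inj; rewrite /= uvalK. Qed.

HB.instance Definition _ := isGroup.Build (units M)
  unit_mulA unit_mul1 unit_mulr1 unit_mulV unit_mulrV.

End UnitsGroup.

Section Adeles.
Variables (R : realType) (F : fieldExtType rat).

Definition totally_real :=
  forall (f : {rmorphism F -> R[i]}) (x : F), f x \is Num.real.

(* When F is totally real, these are all its archimedean places *)
Definition realPlace := {rmorphism F -> R}.
HB.instance Definition _ := gen_eqMixin realPlace.
HB.instance Definition _ := gen_choiceMixin realPlace.

Definition infAdele := prod_topology (fun _ : realPlace => R).
HB.instance Definition _ := Topological.on infAdele.
HB.instance Definition _ := GRing.ComPzRing.copy infAdele (realPlace -> R).

(* The finite adeles: the restricted product of the F_v with respect to their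
   valuation rings O_v *)
Record finAdele := FinAdele {
  fcomp :> forall v : finPlace R F, completion v ;
  fcompP : finite_set [set v | 1 < cabs (fcomp v)] }.

Lemma finAdele_ext (a b : finAdele) : (forall v, a v = b v) -> a = b.
Proof.
case: a b => [a Pa] [b Pb] /= abE.
have ab : a = b by exact: functional_extensionality_dep.
by rewrite -{}ab in Pb *; congr FinAdele; exact: Prop_irrelevance.
Qed.

HB.instance Definition _ := gen_eqMixin finAdele.
HB.instance Definition _ := gen_choiceMixin finAdele.

Fact fa0_subproof : finite_set [set v : finPlace R F | 1 < cabs (0 : completion v)].
Proof.
rewrite (_ : [set _ | _] = set0)//; apply/seteqP; split => // v /=.
by rewrite cabs0 ltNge ler01.
Qed.
Definition fa0 := FinAdele fa0_subproof.

Fact fa1_subproof : finite_set [set v : finPlace R F | 1 < cabs (1 : completion v)].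
Proof.
rewrite (_ : [set _ | _] = set0)//; apply/seteqP; split => // v /=.
by rewrite cabs1 ltxx.
Qed.
Definition fa1 := FinAdele fa1_subproof.

Fact faN_subproof (a : finAdele) : finite_set [set v | 1 < cabs (- a v)].
Proof.
rewrite (_ : [set _ | _] = [set v | 1 < cabs (a v)]); first exact: fcompP.
by apply/seteqP; split => v /=; rewrite cabsN.
Qed.
Definition faN a := FinAdele (faN_subproof a).

Fact faD_subproof (a b : finAdele) : finite_set [set v | 1 < cabs (a v + b v)].
Proof.
apply: (@sub_finite_set _ _ ([set v | 1 < cabs (a v)] `|` [set v | 1 < cabs (b v)])).
  by move=> v /= /lt_le_trans/(_ (cabs_ultra _ _)); rewrite lt_max => /orP.
by rewrite finite_setU; split; exact: fcompP.
Qed.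
Definition faD a b := FinAdele (faD_subproof a b).

Fact faM_subproof (a b : finAdele) : finite_set [set v | 1 < cabs (a v * b v)].
Proof.
apply: (@sub_finite_set _ _ ([set v | 1 < cabs (a v)] `|` [set v | 1 < cabs (b v)])).
  move=> v /=; rewrite cabsM; apply: contraPP => /not_orP[/negP + /negP].
  rewrite -!leNgt => a1 b1; apply/negP; rewrite -leNgt.
  by rewrite mulr_ile1// cabs_ge0.
by rewrite finite_setU; split; exact: fcompP.
Qed.
Definition faM a b := FinAdele (faM_subproof a b).

Fact faDA : associative faD.
Proof. by move=> a b c; apply: finAdele_ext => v; exact: addrA. Qed.
Fact faDC : commutative faD.
Proof. by move=> a b; apply: finAdele_ext => v; exact: addrC. Qed.
Fact fa0D : left_id fa0 faD.
Proof. by move=> a; apply: finAdele_ext => v; exact: add0r. Qed.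
Fact faND : left_inverse fa0 faN faD.
Proof. by move=> a; apply: finAdele_ext => v; exact: addNr. Qed.
HB.instance Definition _ := GRing.isZmodule.Build finAdele faDA faDC fa0D faND.

Fact faMA : associative faM.
Proof. by move=> a b c; apply: finAdele_ext => v; exact: mulrA. Qed.
Fact faMC : commutative faM.
Proof. by move=> a b; apply: finAdele_ext => v; exact: mulrC. Qed.
Fact fa1M : left_id fa1 faM.
Proof. by move=> a; apply: finAdele_ext => v; exact: mul1r. Qed.
Fact faMDl : left_distributive faM faD.
Proof. by move=> a b c; apply: finAdele_ext => v; exact: mulrDl. Qed.
HB.instance Definition _ :=
  GRing.Zmodule_isComPzRing.Build finAdele faMA faMC fa1M faMDl.

Definition finAdele_base : set (set finAdele) := [set B |
  exists U : forall v : finPlace R F, set (completion v),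
    [/\ forall v, open (U v),
        finite_set [set v | U v <> [set a | cabs a <= 1]]
      & B = [set a : finAdele | forall v, U v (a v)]]].

HB.instance Definition _ :=
  @isSubBaseTopological.Build finAdele (set finAdele) finAdele_base id.

Definition adele := (infAdele * finAdele)%type.
HB.instance Definition _ := GRing.ComPzRing.on adele.
HB.instance Definition _ := Topological.on adele.

Definition idele := units adele.
HB.instance Definition _ := Group.on idele.

Definition idele_pair (t : idele) : adele * adele := (uval t, uinv t).
HB.instance Definition _ := Topological.copy idele (initial_topology idele_pair).
HB.instance Definition _ := isPointed.Build idele 1%g.

(* F is identified with its diagonal image in the adele ring: [is_diag x a] means
   that the adele a is the image of x.  Sums over F^2 minus 0 and over F^* are
   sums over the images [principal_vec] and [principal]. *)
Definition is_diag (x : F) (a : adele) : Prop :=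
  (forall s : realPlace, a.1 s = s x) /\
  (forall v : finPlace R F, a.2 v = cemb v x).

Definition principal : set idele :=
  [set t | exists2 x : F, x != 0 & is_diag x (uval t)].

Definition principal_vec : set 'cV[adele]_2 :=
  [set y | exists2 x : 'cV[F]_2, x != 0 & forall i, is_diag (x i 0) (y i 0)].

(* The idelic norm when a is an idele: almost all factors are then 1. *)
Definition idnorm (a : adele) : R :=
  (\big[*%R/1]_(s \in [set: realPlace]) `|a.1 s|) *
  (\big[*%R/1]_(v \in [set: finPlace R F]) cabs (a.2 v)).

Lemma principal1 : principal 1%g.
Proof.
by exists 1; [exact: oner_neq0|split => [s|v]]; rewrite ?rmorph1.
Qed.

Lemma principalM (s t : idele) : principal s -> principal t -> principal (s * t)%g.
Proof.
move=> [x x0 [xi xf]] [y y0 [yi yf]]; exists (x * y); first by rewrite mulf_neq0.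
by split => [p|v]; [rewrite rmorphM -xi -yi|rewrite cembM -xf -yf].
Qed.

Lemma principalV (t : idele) : principal t -> principal t^-1%g.
Proof.
move=> [x x0 [xi xf]]; exists x^-1; first by rewrite invr_eq0.
split => [p|v].
  have tE : (uval t).1 p * (uinv t).1 p = 1.
    by rewrite -[LHS]/((uval t * uinv t).1 p) uvalK.
  have tx : (uval t).1 p != 0 by rewrite xi fmorph_eq0.
  by apply: (mulfI tx); rewrite [LHS]tE fmorphV -xi mulfV.
have tE : (uval t).2 v * (uinv t).2 v = 1.
  by rewrite -[LHS]/((uval t * uinv t).2 v) uvalK.
have tx : (uval t).2 v != 0 by rewrite xf fmorph_eq0.
by apply: (mulfI tx); rewrite [LHS]tE xf -[RHS]cembM mulfV// cemb1.
Qed.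

Definition class_rel : rel idele := fun s t => `[< principal (s^-1 * t)%g >].

Lemma class_rel_equiv : equiv_class_of class_rel.
Proof.
split=> [s|s t|t s u].
- by apply/asboolP; rewrite mulVg; exact: principal1.
- by apply/asboolP/asboolP => /principalV; rewrite invgM invgK.
- move=> /asboolP st /asboolP tu; apply/asboolP.
  by have := principalM st tu; rewrite mulgA mulgK.
Qed.
Canonical class_equiv := EquivRelPack class_rel_equiv.

Definition idele_class := quotient_topology {eq_quot class_equiv}.
HB.instance Definition _ := Topological.on idele_class.
HB.instance Definition _ := Pointed.on idele_class.

Definition borel_idele := g_sigma_algebraType (@open idele).
Definition borel_class := g_sigma_algebraType (@open idele_class).
HB.instance Definition _ := Measurable.on borel_idele.
HB.instance Definition _ := Measurable.on borel_class.

Definition haar_measure (mu : {measure set borel_idele -> \bar R}) : Prop :=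
  [/\ forall (t : idele) (B : set borel_idele), measurable B ->
        mu [set (t * b)%g | b in B] = mu B,
      forall K : set idele, compact K -> (mu K < +oo)%E
    & forall U : set idele, open U -> U !=set0 -> (0 < mu U)%E].

(* Weil's formula characterises the quotient measure, F^* carrying the counting
   measure; the inner sum does not depend on the representative of c *)
Definition quotient_measure (mu : {measure set borel_idele -> \bar R})
    (nu : {measure set borel_class -> \bar R}) : Prop :=
  forall f : borel_idele -> \bar R,
    measurable_fun setT f -> (forall t, 0 <= f t)%E ->
    (\int[mu]_t f t =
     \int[nu]_c \esum_(x in principal) f (x * repr (c : idele_class))%g)%E.

Definition unitary_hecke_character (omega : idele -> R[i]) : Prop :=
  [/\ continuous omega,
      forall s t : idele, omega (s * t)%g = omega s * omega t,
      forall t, `|omega t| = 1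
    & forall t, principal t -> omega t = 1].

Definition axis_line (x : 'cV[infAdele]_2) (d : 'I_2 * realPlace) (t : R) :
    'cV[infAdele]_2 :=
  \col_i (fun s => x i 0 s + (if (i, s) == d then t else 0)).

Definition partial (d : 'I_2 * realPlace) (f : 'cV[infAdele]_2 -> R)
    (x : 'cV[infAdele]_2) : R :=
  derive1 (fun t => f (axis_line x d t)) 0.

Definition partials (l : seq ('I_2 * realPlace)) (f : 'cV[infAdele]_2 -> R) :=
  foldr partial f l.

Definition monomial (m : seq ('I_2 * realPlace)) (x : 'cV[infAdele]_2) : R :=
  \prod_(d <- m) x d.1 0 d.2.

(* The iterated partial derivatives are then continuous, since they have bounded
   partial derivatives, so f is smooth. *)
Definition real_schwartz (f : 'cV[infAdele]_2 -> R) : Prop :=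
  (forall l d x, derivable (fun t => partials l f (axis_line x d t)) 0 1) /\
  (forall l m, exists C : R, forall x, `|monomial m x * partials l f x| <= C).

Definition schwartz (f : 'cV[infAdele]_2 -> R[i]) : Prop :=
  real_schwartz (fun x => complex.Re (f x)) /\
  real_schwartz (fun x => complex.Im (f x)).

Definition bruhat (f : 'cV[finAdele]_2 -> R[i]) : Prop :=
  (forall x, \forall y \near x, f y = f x) /\
  compact (closure [set x | f x != 0]).

(* The algebraic tensor product of S(A_oo^2) and S(A_f^2) *)
Definition schwartz_bruhat (phi : 'cV[adele]_2 -> R[i]) : Prop :=
  exists (n : nat) (f : 'I_n -> 'cV[infAdele]_2 -> R[i])
         (g : 'I_n -> 'cV[finAdele]_2 -> R[i]),
    [/\ forall i, schwartz (f i), forall i, bruhat (g i)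
      & forall x, phi x = \sum_i f i (map_mx fst x) * g i (map_mx snd x)].

Definition GL2 := units 'M[adele]_2.
Definition GL2f := units 'M[finAdele]_2.
HB.instance Definition _ := Group.on GL2.
HB.instance Definition _ := Group.on GL2f.

Fact scalar_subproof (a b : adele) : a * b = 1 -> (a%:M : 'M[adele]_2) * b%:M = 1.
Proof. by move=> ab; rewrite -[LHS]scalar_mxM ab. Qed.

Definition scalar_GL2 (t : idele) : GL2 :=
  Units (scalar_subproof (uvalK t)) (scalar_subproof (uinvK t)).

(* GL_2(A_f) as a subgroup of GL_2(A), with identity archimedean components *)
Definition fin_mx (h : 'M[finAdele]_2) : 'M[adele]_2 :=
  \matrix_(i, j) ((1%:M : 'M[infAdele]_2) i j, h i j).

Fact fin_mx_subproof (h k : 'M[finAdele]_2) : h * k = 1 -> fin_mx h * fin_mx k = 1.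
Proof.
move=> hk; apply/matrixP => i j.
have -> : (fin_mx h * fin_mx k) i j =
    (((1%:M : 'M[infAdele]_2) *m 1%:M) i j, (h * k) i j).
  rewrite !mxE; elim/big_rec3: _ => // l x y z _ ->.
  by rewrite !mxE.
by rewrite mulmx1 hk !mxE; case: (i == j).
Qed.

Definition fin_GL2 (h : GL2f) : GL2 :=
  Units (fin_mx_subproof (uvalK h)) (fin_mx_subproof (uinvK h)).

Definition integer (x : F) : Prop := integralOver (intr : int -> F) x.

(* The profinite completion of O, i.e. the inverse limit of the O/nO, as a
   subset of A_f: a compatible family of classes x_n + nO corresponds to the
   finite adele a with |a_v - x_n|_v <= |n|_v for all n and v. *)
Definition Ohat : set finAdele := [set a | exists x : nat -> F,
  [/\ forall n, (0 < n)%N -> integer (x n),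
      forall m n, (0 < m)%N -> (0 < n)%N -> (m %| n)%N ->
        exists2 y, integer y & x n - x m = m%:R * y
    & forall n (v : finPlace R F), (0 < n)%N ->
        cabs (a v - cemb v (x n)) <= v n%:R]].

Definition GL2_Ohat : set GL2f :=
  [set h : GL2f | forall i j : 'I_2,
    Ohat ((uval h : 'M[finAdele]_2) i j) /\ Ohat ((uinv h : 'M[finAdele]_2) i j)].

Definition is_subgroup (K : set GL2f) : Prop :=
  [/\ K 1%g, forall h k, K h -> K k -> K (h * k)%g & forall h, K h -> K h^-1%g].

Definition finite_index (K H : set GL2f) : Prop :=
  finite_set [set [set (h * k)%g | k in K] | h in H].

(* The power a ^ s, meaningful for a > 0 *)
Definition cpow (a : R) (s : R[i]) : R[i] :=
  let r := expR (complex.Re s * ln a) in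
  let theta := complex.Im s * ln a in
  Complex (r * cos theta) (r * sin theta).

(* Unordered sums, meaningful for absolutely summable families *)
Definition rsum (T : choiceType) (D : set T) (f : T -> R) : R :=
  fine (\esum_(x in D) (Num.max (f x) 0)%:E) -
  fine (\esum_(x in D) (Num.max (- f x) 0)%:E).

Definition csum (T : choiceType) (D : set T) (f : T -> R[i]) : R[i] :=
  Complex (rsum D (fun x => complex.Re (f x))) (rsum D (fun x => complex.Im (f x))).

Definition cintegral (nu : {measure set borel_class -> \bar R})
    (f : borel_class -> R[i]) : R[i] :=
  Complex (\int[nu]_c complex.Re (f c)) (\int[nu]_c complex.Im (f c)).

Definition Theta (phi : 'cV[adele]_2 -> R[i]) (g : GL2) : R[i] :=
  csum principal_vec (fun y => phi (uinv g *m y)).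

Definition eisenstein (nu : {measure set borel_class -> \bar R})
    (omega : idele -> R[i]) (phi : 'cV[adele]_2 -> R[i]) (g : GL2) (s : R[i]) :
    R[i] :=
  cpow (idnorm (\det (uval g))) (- s) *
  cintegral nu (fun c => let t := repr (c : idele_class) in
    omega t * cpow (idnorm (uval t)) (2 * s) *
    Theta phi ((scalar_GL2 t)^-1 * g)%g).

Definition eisenstein_continuation (nu : {measure set borel_class -> \bar R})
    (omega : idele -> R[i]) (phi : 'cV[adele]_2 -> R[i]) (g : GL2)
    (E : R[i] -> option R[i]) : Prop :=
  meromorphic E /\
  forall s, 1 < complex.Re s -> E s = Some (eisenstein nu omega phi g s).

End Adeles.

(* Main.v *)
(* The Eisenstein series depends on g only through |det g| and the values of
   phi (g^-1 y), so it is unchanged under g -> g h as soon as h and h^-1 are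
   integral and phi (h^-1 y) = phi y.  The subgroups of finite index defined by
   finitely many congruences at finite places generate a filter on GL_2(A_f); the
   action of GL_2(Ohat) on A_f^2 is continuous for this filter, so compactness
   of the support turns the local constancy of the finite components of phi
   into their invariance under one such subgroup.  The continuations then agree
   on a half-plane, hence everywhere by the identity theorem. *)
Require Import Defs.
From HB Require Import structures.
From mathcomp Require Import all_boot all_order all_algebra all_field.
From mathcomp Require Import complex ring lra finmap.
From mathcomp Require Import all_classical all_reals all_analysis.

Set Implicit Arguments.
Unset Strict Implicit.
Unset Printing Implicit Defensive.

Import Order.TTheory GRing.Theory Num.Theory.
Import numFieldNormedType.Exports.
Local Open Scope classical_set_scope.
Local Open Scope ring_scope.

(** * Absolute values at a finite place *)

Section FinPlaceTheory.
Variables (R : realType) (F : fieldType) (v : finPlace R F).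

Lemma pabsX x n : v (x ^+ n) = v x ^+ n.
Proof. by elim: n => [|n IH]; rewrite ?pabs1// !exprS pabsM IH. Qed.

Lemma pabs_sum_le (I : Type) (r : seq I) (P : pred I) (f : I -> F) (B : R) :
  0 <= B -> (forall i, P i -> v (f i) <= B) -> v (\sum_(i <- r | P i) f i) <= B.
Proof.
move=> B0 fB; elim/big_ind: _ => //; first by rewrite pabs0.
by move=> x y xB yB; rewrite (le_trans (pabs_ultra v x y))// ge_max xB.
Qed.

Lemma pabs_nat_le1 n : v n%:R <= 1.
Proof.
elim: n => [|n IH]; first by rewrite pabs0.
by rewrite -natr1 (le_trans (pabs_ultra _ _ _))// ge_max IH pabs1 lexx.
Qed.

Lemma pabs_int_le1 (z : int) : v z%:~R <= 1.
Proof.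
case: z => n; first exact: pabs_nat_le1.
by rewrite NegzE rmorphN /= pabsN pabs_nat_le1.
Qed.

(** If [v x > 1], the leading term of a monic equation of degree d has value [v x ^+ d], while every
    lower term has value at most [v x ^+ d / v x], so the ultrametric inequality forbids
    cancellation. *)
Lemma pabs_integral_le1 x : integralOver (intr : int -> F) x -> v x <= 1.
Proof.
move=> [p p_monic /rootP]; rewrite leNgt => px0; apply/negP => x1.
have x0 : 0 < v x by rewrite (lt_trans ltr01).
have sp : size (map_poly (intr : int -> F) p) = (size p).-1.+1.
  rewrite size_map_poly_id0 ?(monicP p_monic) ?oner_neq0//.
  by rewrite prednK// lt0n size_poly_eq0 monic_neq0.
move: px0; rewrite horner_coef sp big_ord_recr /= coef_map -lead_coefE.
rewrite (monicP p_monic) mul1r => /eqP; rewrite addrC addr_eq0 => /eqP xn.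
suff : v x ^+ (size p).-1 <= v x ^+ (size p).-1 / v x.
  rewrite ler_pdivlMr// ger_pMr ?exprn_gt0//.
  by rewrite leNgt x1.
rewrite -{1}pabsX xn pabsN; apply: pabs_sum_le => [|i _].
  by rewrite divr_ge0 ?exprn_ge0 ?(ltW x0).
rewrite pabsM coef_map ler_pdivlMr// pabsX.
rewrite -[leRHS]mul1r -mulrA -exprSr ler_pM ?pabs_ge0 ?exprn_ge0 ?pabs_int_le1//.
  exact: ltW.
by rewrite ler_weXn2l// ltW.
Qed.

(* The closed balls of radius q^-n with centres in the net of step n.+1 are
   obtained from those of step n by adding multiples of x^n, v x = 1/q. *)
Lemma pabs_ball_net (e : R) : 0 < e ->
  exists s : seq F, forall x, v x <= 1 -> exists2 c, c \in s & v (x - c) <= e.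
Proof.
move=> e0; have [q [r [r1 rP vq [pi vpi]]]] := pabs_normalised v.
(* With [q = 0] the element 0 would have no representative; with [q = 1] both 0 and 1 would lie in
   the same residue class, giving [v 1 < 1]. *)
have q1 : (1 < q)%N.
  case: q r r1 rP vq vpi => [|[|q]]// r r1 rP vq vpi.
    by have [[]] : exists! i : 'I_0, v (0 - r i) < 1 by apply: rP; rewrite pabs0 ler01.
  have [|i [i0 _]] := rP 0; first by rewrite pabs0 ler01.
  have [|j [j1 _]] := rP 1; first by rewrite pabs1.
  suff : v 1 < 1 by rewrite pabs1 ltxx.
  have -> : 1 = (1 - r j) - (0 - r i) by rewrite (ord1 i) (ord1 j); ring.
  by rewrite (le_lt_trans (pabsB_ultra _ _ _))// gt_max i0 j1.
have q0 : 0 < q%:R :> R by rewrite ltr0n (ltn_trans _ q1).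
have pi0 : pi != 0 by rewrite -(pabs_eq0 v) vpi invr_eq0 gt_eqF.
have net n : exists s : seq F, forall x, v x <= 1 ->
    exists2 c, c \in s & v (x - c) <= q%:R^-1 ^+ n.
  elim: n => [|n [s sP]].
    by exists [:: 0] => x x1; exists 0; rewrite ?mem_head// subr0 expr0.
  exists [seq c + pi ^+ n * r i | c <- s, i <- enum 'I_q] => x /sP[c cs xc].
  have pin : v (pi ^+ n) = q%:R^-1 ^+ n by rewrite pabsX vpi.
  have pin0 : 0 < v (pi ^+ n) by rewrite pin exprn_gt0// invr_gt0.
  (* The rescaled error is integral, hence congruent to some [r i]; normalisation turns the strict
     bound 1 on the new error into [q%:R^-1]. *)
  have [|i [yi _]] := rP ((x - c) / pi ^+ n).
    by rewrite pabsM pabsV ler_pdivrMr// mul1r pin.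
  exists (c + pi ^+ n * r i).
    by apply/allpairsP; exists (c, i); rewrite /= mem_enum.
  rewrite (_ : x - _ = ((x - c) / pi ^+ n - r i) * pi ^+ n); last first.
    by rewrite mulrBl divfK ?expf_neq0//; ring.
  by rewrite pabsM pin exprS ler_wpM2r ?exprn_ge0 ?invr_ge0 ?(ltW q0)// vq.
have [n ne] : exists n, q%:R^-1 ^+ n <= e.
  have q1' : `|q%:R^-1 : R| < 1.
    by rewrite ger0_norm ?invr_ge0 ?ltW// invf_lt1// ltr1n.
  have /cvgrPdist_le/(_ _ e0)[N _ /(_ N (leqnn N))] := cvg_expr q1'.
  rewrite sub0r normrN ger0_norm ?exprn_ge0 ?invr_ge0 ?(ltW q0)// => ?.
  by exists N.
by have [s sP] := net n; exists s => x /sP[c cs xc]; exists c => //; exact: le_trans xc ne.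
Qed.

Lemma cabsB_ultra (a b : completion v) :
  cabs (a - b) <= Num.max (cabs a) (cabs b).
Proof. by rewrite -(cabsN b) cabs_ultra. Qed.

Lemma cabs_distC (a b : completion v) : cabs (a - b) = cabs (b - a).
Proof. by rewrite -cabsN opprB. Qed.

Lemma cabs_sum_le (I : Type) (r : seq I) (P : pred I) (f : I -> completion v)
    (B : R) : 0 <= B -> (forall i, P i -> cabs (f i) <= B) ->
  cabs (\sum_(i <- r | P i) f i) <= B.
Proof.
move=> B0 fB; elim/big_ind: _ => //; first by rewrite cabs0.
by move=> x y xB yB; rewrite (le_trans (cabs_ultra x y))// ge_max xB.
Qed.

Lemma cemb_dense (a : completion v) (e : R) : 0 < e ->
  exists x, cabs (a - cemb v x) <= e.
Proof.
move=> e0; have /asboolP/(_ _ e0)[N uN] := cseqP (repr a).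
exists (repr a N); rewrite -{1}[a]reprK /cemb -pi_oppE -pi_addE cabs_pi.
apply: limr_le; first exact: cauchy_pabs_cvg (cseqP (_ - _)).
by exists N => // n Nn; apply: ltW; exact: uN.
Qed.

(** Total boundedness of the valuation ring. The class of [a] records which points of a finite net
    lie within [e] of it, and integral elements with equal records share a net point. *)
Lemma cabs_ball_finite (e : R) : 0 < e -> exists (T : finType)
  (c : completion v -> T), forall a b, cabs a <= 1 -> cabs b <= 1 ->
    c a = c b -> cabs (a - b) <= e.
Proof.
move=> e0; have [s sP] := pabs_ball_net e0.
pose c (a : completion v) :=
  [ffun i : 'I_(size s) => cabs (a - cemb v s`_i) <= e].
exists {ffun 'I_(size s) -> bool}, c => a b a1 b1 /ffunP cab.
(* The bound 1 keeps the approximation [x] in the valuation ring, where the net applies; the bound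
   [e] transfers the net point of [x] to [a]. *)
have d0 : 0 < Num.min 1 e by rewrite lt_min ltr01.
have [x] := cemb_dense a d0; rewrite le_min => /andP[ax1 axe].
have x1 : v x <= 1.
  rewrite -cabs_emb -[cemb v x](subKr a) (le_trans (cabsB_ultra _ _))//.
  by rewrite ge_max a1.
have [y ys xy] := sP x x1.
pose i := Ordinal (etrans (index_mem y s) ys).
have ay : c a i.
  rewrite /c ffunE /= nth_index// -(subrK (cemb v x) a) -addrA.
  by rewrite (le_trans (cabs_ultra _ _))// ge_max axe -cembB cabs_emb.
have by_ : c b i by rewrite -cab.
move: ay by_; rewrite /c !ffunE => ay by_.
rewrite -(subrK (cemb v s`_i) a) -addrA (le_trans (cabs_ultra _ _))//.
by rewrite ge_max ay cabs_distC.
Qed.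

End FinPlaceTheory.

(** * Entrywise bounds for matrices over a completion *)

Section MatrixBound.
Variables (R : realType) (F : fieldType) (v : finPlace R F).

Definition mx_le m n (A : 'M[completion v]_(m, n)) (B : R) :=
  forall i j, cabs (A i j) <= B.

Lemma mx_leD m n (A C : 'M[completion v]_(m, n)) B : mx_le A B -> mx_le C B -> mx_le (A + C) B.
Proof.
by move=> AB CB i j; rewrite mxE (le_trans (cabs_ultra _ _))// ge_max AB CB.
Qed.

Lemma mx_leN m n (A : 'M[completion v]_(m, n)) B : mx_le A B -> mx_le (- A) B.
Proof. by move=> AB i j; rewrite mxE cabsN. Qed.

(** Sums do not enlarge an ultrametric bound, hence the absence of a factor [n]. *)
Lemma mx_leM m n p (A : 'M[completion v]_(m, n))
    (C : 'M[completion v]_(n, p)) B D : 0 <= B -> 0 <= D ->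
  mx_le A B -> mx_le C D -> mx_le (A *m C) (B * D).
Proof.
move=> B0 D0 AB CD i j; rewrite mxE; apply: cabs_sum_le => [|k _].
  exact: mulr_ge0.
by rewrite cabsM ler_pM ?cabs_ge0.
Qed.

Lemma mx_le_det n (A : 'M[completion v]_n) : mx_le A 1 -> cabs (\det A) <= 1.
Proof.
move=> A1; apply: cabs_sum_le => // s _; rewrite cabsM.
have -> : cabs ((-1) ^+ perm.odd_perm s : completion v) = 1.
  by case: (perm.odd_perm s); rewrite ?expr1 ?expr0 ?cabsN cabs1.
rewrite mul1r; elim/big_ind: _ => //; first by rewrite cabs1.
by move=> x y x1 y1; rewrite cabsM mulr_ile1 ?cabs_ge0.
Qed.

End MatrixBound.

(** * Congruence subgroups of GL_2(Ohat) *)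

Section FiniteAdeles.
Variables (R : realType) (F : fieldExtType rat).
Local Notation finAdele := (finAdele R F).
Local Notation GL2f := (GL2f R F).
Local Notation GL2_Ohat := (@GL2_Ohat R F).
Local Notation Ohat := (@Ohat R F).

(** Named so that evaluation at a place can carry a ring morphism structure and be applied to
    matrices. *)
Definition fcoord (v : finPlace R F) (a : finAdele) : completion v := a v.

Fact fcoordB v : {morph fcoord v : a b / a - b}. Proof. by []. Qed.
Fact fcoordM v : monoid_morphism (fcoord v). Proof. by []. Qed.
HB.instance Definition _ v :=
  GRing.isZmodMorphism.Build finAdele (completion v) (fcoord v) (@fcoordB v).
HB.instance Definition _ v :=
  GRing.isMonoidMorphism.Build finAdele (completion v) (fcoord v) (@fcoordM v).

(** The member of index 1 of the compatible family is integral and within [v 1 = 1] of [a v]. *)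
Lemma Ohat_le1 a v : Ohat a -> cabs (a v) <= 1.
Proof.
move=> [x [xint _ xa]]; rewrite -(subrK (cemb v (x 1%N)) (a v)).
rewrite (le_trans (cabs_ultra _ _))// ge_max cabs_emb; apply/andP; split.
  by apply: le_trans (xa 1%N v isT) _; rewrite pabs1.
by apply: pabs_integral_le1; exact: xint.
Qed.

Lemma Ohat_nat n : Ohat n%:R.
Proof.
exists (fun=> n%:R); split=> [m _|m k _ _ _|m v _].
- exact: (integral_nat intr).
- by exists 0; [exact: (integral_nat intr 0) | rewrite subrr mulr0].
- rewrite -[X in X - _]/(fcoord v _) !rmorph_nat subrr cabs0.
  exact: pabs_ge0.
Qed.

Lemma OhatD a b : Ohat a -> Ohat b -> Ohat (a + b).
Proof.
move=> [x [xint xn xa]] [y [yint yn yb]]; exists (fun n => x n + y n); split.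
- by move=> n n0; apply: (integral_add (xint n n0) (yint n n0)).
- move=> m n m0 n0 mn; have [z zint xz] := xn _ _ m0 n0 mn.
  have [w wint yw] := yn _ _ m0 n0 mn; exists (z + w); first exact: integral_add.
  by rewrite mulrDr -xz -yw; ring.
- move=> n v n0; rewrite rmorphD /= -[X in X - _]/(a v + b v) opprD addrACA.
  by rewrite (le_trans (cabs_ultra _ _))// ge_max xa ?yb.
Qed.

Lemma OhatM a b : Ohat a -> Ohat b -> Ohat (a * b).
Proof.
move=> Oa [y [yint yn yb]]; have [x [xint xn xa]] := Oa.
exists (fun n => x n * y n); split.
- by move=> n n0; apply: (integral_mul (xint n n0) (yint n n0)).
- move=> m n m0 n0 mn; have [z zint xz] := xn _ _ m0 n0 mn.
  have [w wint yw] := yn _ _ m0 n0 mn; exists (z * y n + x m * w).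
    by apply: integral_add; apply: integral_mul => //; [exact: yint|exact: xint].
  by rewrite mulrDr mulrA -xz mulrCA -yw; ring.
- move=> n v n0; rewrite rmorphM /= -[X in X - _]/(a v * b v).
  (* Both [a v] and [cemb v (y n)] have absolute value at most 1, so each summand inherits the bound
     [v n%:R] of an approximation error. *)
  have -> : a v * b v - cemb v (x n) * cemb v (y n) =
    a v * (b v - cemb v (y n)) + (a v - cemb v (x n)) * cemb v (y n) by ring.
  rewrite (le_trans (cabs_ultra _ _))// ge_max !cabsM; apply/andP; split.
    by rewrite -[leRHS]mul1r ler_pM ?cabs_ge0 ?yb ?Ohat_le1.
  rewrite -[leRHS]mulr1 ler_pM ?cabs_ge0 ?xa// cabs_emb.
  by apply: pabs_integral_le1; exact: yint.
Qed.

Lemma Ohat_sum (I : Type) (r : seq I) (f : I -> finAdele) :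
  (forall i, Ohat (f i)) -> Ohat (\sum_(i <- r) f i).
Proof.
move=> Of; elim/big_ind: _ => //; first exact: (Ohat_nat 0).
exact: OhatD.
Qed.

Lemma GL2_Ohat_subgroup : is_subgroup GL2_Ohat.
Proof.
split.
- have Ohat1 i j : Ohat ((1 : 'M[finAdele]_2) i j) by rewrite mxE; exact: Ohat_nat.
  by move=> i j; split; exact: Ohat1.
- move=> h k Oh Ok i j; split; rewrite mxE; apply: Ohat_sum => l.
  + by apply: OhatM; [exact: (Oh _ _).1 | exact: (Ok _ _).1].
  + by apply: OhatM; [exact: (Ok _ _).2 | exact: (Oh _ _).2].
- by move=> h Oh i j; have [] := Oh i j.
Qed.

Definition fmx v m n (A : 'M[finAdele]_(m, n)) : 'M[completion v]_(m, n) :=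
  map_mx (fcoord v) A.

Lemma GL2_Ohat_le1 (h : GL2f) v : GL2_Ohat h -> mx_le (fmx v (uval h)) 1.
Proof. by move=> Oh i j; rewrite mxE; apply: Ohat_le1; exact: (Oh i j).1. Qed.

(** For [0 < e < 1] this is a principal congruence subgroup at the single place [v]; for [e >= 1] it
    is all of [GL2_Ohat]. *)
Definition congruence v e : set GL2f :=
  GL2_Ohat `&` [set h | mx_le (fmx v (uval h) - 1%:M) e].

(* Elements of GL_2(Ohat) with the same class under c are in the same left coset
   of K: this form of finiteness of the index passes to intersections. *)
Definition level_group (K : set GL2f) := [/\ is_subgroup K, K `<=` GL2_Ohat &
  exists (T : finType) (c : GL2f -> T), forall h k, GL2_Ohat h -> GL2_Ohat k ->
    c h = c k -> K (h^-1 * k)%g].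

Lemma level_group_Ohat : level_group GL2_Ohat.
Proof.
have [Ohat1 OhM OhV] := GL2_Ohat_subgroup; split => //.
by exists unit, (fun=> tt) => h k Oh Ok _; apply: OhM => //; exact: OhV.
Qed.

Lemma level_groupI K L : level_group K -> level_group L -> level_group (K `&` L).
Proof.
move=> [[K1 KM KV] KO [S [c cP]]] [[L1 LM LV] LO [T [d dP]]]; split.
- split => //.
  + by move=> h k [Kh Lh] [Kk Lk]; split; [exact: KM|exact: LM].
  + by move=> h [Kh Lh]; split; [exact: KV|exact: LV].
- by move=> h [/KO].
- exists (S * T)%type, (fun h => (c h, d h)) => h k Oh Ok [ch dh].
  by split; [exact: cP|exact: dP].
Qed.

(** Multiplication by integral matrices preserves the bound [e]. For the index,
    [h^-1 k - 1 = h^-1 (k - h)], so it is enough to classify the four entries of [h] up to distance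
    [e]. *)
Lemma level_group_congruence v e : 0 < e -> level_group (congruence v e).
Proof.
move=> e0; have [Ohat1 OhM OhV] := GL2_Ohat_subgroup; have e0' := ltW e0.
split; last 1 first.
- have [T [c cP]] := cabs_ball_finite v e0.
  exists {ffun 'I_2 * 'I_2 -> T},
    (fun h => [ffun ij => c (fmx v (uval h) ij.1 ij.2)]) => h k Oh Ok /ffunP hk.
  split; first by apply: OhM => //; exact: OhV.
  rewrite /mkset.
  have -> : fmx v (uval (h^-1 * k)%g) - 1%:M =
      fmx v (uval h^-1%g) *m (fmx v (uval k) - fmx v (uval h)).
    rewrite mulmxBr -!map_mxM; congr (fmx v _ - _).
    by rewrite -[_ *m _]/(uinv h * uval h) uinvK map_mx1.
  rewrite -[e]mul1r; apply: mx_leM => //; first exact: (GL2_Ohat_le1 v (OhV _ Oh)).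
  move=> i j; rewrite [X in cabs X]mxE [X in _ + X]mxE cabs_distC.
  apply: cP; [exact: GL2_Ohat_le1..|].
  by have := hk (i, j); rewrite !ffunE.
- split.
  + split => // i j; rewrite /fmx map_mx1 subrr mxE cabs0; exact: ltW.
  + move=> h k [Oh he] [Ok ke]; split; first exact: OhM.
    rewrite /mkset.
    have -> : fmx v (uval (h * k)%g) - 1%:M =
        (fmx v (uval h) - 1%:M) *m fmx v (uval k) + (fmx v (uval k) - 1%:M).
      by rewrite mulmxBl mul1mx addrA subrK -map_mxM.
    apply: mx_leD => //; rewrite -[e]mulr1; apply: mx_leM => //.
    exact: GL2_Ohat_le1.
  + move=> h [Oh he]; split; first exact: OhV.
    rewrite /mkset.
    have -> : fmx v (uval h^-1%g) - 1%:M =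
        - (fmx v (uval h^-1%g) *m (fmx v (uval h) - 1%:M)).
      rewrite mulmxBr mulmx1 opprB -map_mxM; congr (_ - _).
      by rewrite -[_ *m _]/(uinv h * uval h) uinvK map_mx1.
    apply: mx_leN; rewrite -[e]mul1r; apply: mx_leM => //.
    exact: (GL2_Ohat_le1 v (OhV _ Oh)).
- by move=> h [].
Qed.

Lemma level_group_finite_index K : level_group K -> finite_index K GL2_Ohat.
Proof.
move=> [[K1 KM KV] KO [T [c cP]]].
(* One representative per class; the default [1%g] is taken only at classes that no element of
   [GL2_Ohat] attains. Every coset is then that of some [rep t]. *)
pose rep t : GL2f := xget 1%g [set h | GL2_Ohat h /\ c h = t].
apply: (@sub_finite_set _ _
  [set [set (rep t * k)%g | k in K] | t in [set: T]]); last first.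
  by apply: finite_image; exact: finite_finset.
move=> _ [h Oh <-]; exists (c h) => //.
have [Or cr] : GL2_Ohat (rep (c h)) /\ c (rep (c h)) = c h.
  by rewrite /rep; case: xgetP => [_ _ //|/(_ h)[]].
have Kr := cP _ _ Or Oh cr; have Kr' := cP _ _ Oh Or (esym cr).
apply/seteqP; split => _ [k Kk <-].
  by exists (h^-1 * rep (c h) * k)%g; [exact: KM|rewrite !mulgA mulgV mul1g].
exists ((rep (c h))^-1 * h * k)%g; first exact: KM.
by rewrite !mulgA mulgV mul1g.
Qed.

(** The choice of a small enough group becomes a [near] statement, the form that
    [compact_near_coveringP] handles. *)
Definition level_filter : set_system GL2f := filter_from level_group id.

Global Instance level_filter_filter : Filter level_filter.
Proof.
apply: filter_from_filter; first by exists GL2_Ohat; exact: level_group_Ohat.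
by move=> K L lK lL; exists (K `&` L) => //; exact: level_groupI.
Qed.

Lemma near_congruence v e : 0 < e -> \forall h \near level_filter, congruence v e h.
Proof. by move=> /(level_group_congruence v) ?; exists (congruence v e). Qed.

Lemma near_congruences (S : set (finPlace R F)) (e : finPlace R F -> R) :
  finite_set S -> (forall v, 0 < e v) ->
  \forall h \near level_filter, forall v, S v -> congruence v (e v) h.
Proof.
move=> /finite_seqP[s ->] e0; elim: s => [|v s IH].
  by apply: nearW => h v; rewrite /= in_nil.
near=> h => w; rewrite /= inE => /orP[/eqP ->|ws].
  by near: h; exact: near_congruence.
by move: w ws; near: h.
Unshelve. all: by end_near. Qed.

End FiniteAdeles.

(** * The action on the finite adeles *)

Lemma ord2_ind (P : 'I_2 -> Prop) : P 0 -> P 1 -> forall i, P i.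
Proof.
move=> P0 P1 [[|[|//]] i2]; first by rewrite (_ : Ordinal i2 = 0)//; exact: val_inj.
by rewrite (_ : Ordinal i2 = 1)//; exact: val_inj.
Qed.

Section FiniteAdeleTopology.
Variables (R : realType) (F : fieldExtType rat).
Local Notation finAdele := (finAdele R F).
Local Notation GL2f := (GL2f R F).
Local Notation GL2_Ohat := (@GL2_Ohat R F).
Implicit Types (a b : finAdele) (r : finPlace R F -> R).

(** * Neighbourhood bases of the finite adeles *)

Definition radii r := (forall v, 0 < r v) /\ finite_set [set v | r v <> 1].

(** For [radii r] these boxes are a neighbourhood basis at [a]: radius 1 at almost every place
    matches the valuation rings of the restricted product, and closed balls are open because the
    absolute value is ultrametric. *)
Definition fbox a r : set finAdele := [set b | forall v, cabs (b v - a v) <= r v].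

Lemma radii_min r r' : radii r -> radii r' -> radii (fun v => Num.min (r v) (r' v)).
Proof.
move=> [r0 rf] [r'0 r'f]; split=> [v|]; first by rewrite lt_min r0 r'0.
apply: (@sub_finite_set _ _ ([set v | r v <> 1] `|` [set v | r' v <> 1])).
  move=> v /= rr'; apply: contrapT => /not_orP[/contrapT rv /contrapT r'v].
  by apply: rr'; rewrite rv r'v minxx.
by rewrite finite_setU.
Qed.

Lemma fbox_filter a : Filter (filter_from radii (fbox a)).
Proof.
apply: filter_from_filter.
  exists (fun=> 1); split=> [v|]; first exact: ltr01.
  by rewrite (_ : [set _ | _] = set0)//; apply/seteqP; split => v.
move=> r r' rr rr'; exists (fun v => Num.min (r v) (r' v)); first exact: radii_min.
by move=> b ab; split=> v; have := ab v; rewrite le_min => /andP[].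
Qed.

Lemma nbhs_fbox a r : radii r -> nbhs a (fbox a r).
Proof.
move=> [r0 rf]; rewrite nbhsE.
exists [set b : finAdele | forall v, [set c | cabs (c - a v) <= r v] (b v)] => //.
split; last first.
  by move=> v /=; rewrite subrr cabs0 ltW.
pose B := [set b : finAdele | forall v, [set c | cabs (c - a v) <= r v] (b v)].
have Bbase : finAdele_base B.
  exists (fun v => [set c | cabs (c - a v) <= r v]); split => //.
    move=> v; suff : copen [set c | cabs (c - a v) <= r v] by [].
    move=> c /= cr; exists (r v) => // b bc.
    rewrite -(subrK c b) -addrA (le_trans (cabs_ultra _ _))// ge_max cr andbT.
    exact: ltW.
  (* Where [r v = 1] and [a v] is integral, the ball around [a v] is the valuation ring itself. *)
  apply: (@sub_finite_set _ _ ([set v | r v <> 1] `|` [set v | 1 < cabs (a v)])).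
    move=> v /=; apply: contraPP => /not_orP[/contrapT rv /negP].
    rewrite -leNgt rv => av; apply; apply/seteqP; split => c /= ca.
      by rewrite -(subrK (a v) c) (le_trans (cabs_ultra _ _))// ge_max ca.
    by rewrite (le_trans (cabsB_ultra _ _))// ge_max ca.
  by rewrite finite_setU; split => //; exact: fcompP.
exists [set B]; last by rewrite bigcup_set1.
move=> _ ->; exists [fset B]%fset; first by move=> i /fset1P ->; rewrite inE.
by rewrite set_fset1 bigcap_set1.
Qed.

Lemma finAdele_base_fbox a B : finAdele_base B -> B a ->
  filter_from radii (fbox a) B.
Proof.
move=> [U [Uo Uf ->]] Ua.
have /choice[r rP] : forall v, exists e : R, [/\ 0 < e,
    U v = [set c | cabs c <= 1] -> e = 1
  & forall c, cabs (c - a v) <= e -> U v c].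
  move=> v; have [UO|UO] := pselect (U v = [set c | cabs c <= 1]).
    exists 1; split => // c ca; have := Ua v; rewrite UO /= => av.
    by rewrite -(subrK (a v) c) (le_trans (cabs_ultra _ _))// ge_max ca.
  (* Openness provides a strict inequality, while boxes use large ones; hence the half radius. *)
  have [e e0 eU] := Uo v _ (Ua v); exists (e / 2); split => //.
    by rewrite divr_gt0.
  by move=> c ca; apply: eU; rewrite (le_lt_trans ca)// ltr_pdivrMr// ltr_pMr// ltr1n.
exists r; last by move=> b ab v; have [_ _] := rP v; apply; exact: ab.
split=> [v|]; first by have [] := rP v.
apply: sub_finite_set Uf => v /= rv UO; apply: rv.
by have [_ + _] := rP v; apply.
Qed.

Lemma fbox_nbhs a P : nbhs a P -> filter_from radii (fbox a) P.
Proof.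
have FF := fbox_filter a.
rewrite nbhsE => -[U [[D' sD' <-] [B D'B Ba]] UP].
apply: (filterS UP); apply: (@filterS _ _ _ B); first by move=> b Bb; exists B.
have [D sD DB] := sD' _ D'B; rewrite -DB.
apply: filter_bigI => C CD; apply: finAdele_base_fbox.
  by have := sD _ CD; rewrite inE.
by move: Ba; rewrite -DB => /(_ C CD).
Qed.

(* Outside a finite set of places v, both x and the ball of
   radius r v around x lie in O_v^2, which GL_2(O_v) preserves; at the
   remaining places h only has to be close to 1. *)
Lemma nbhs_level_action (x : 'cV[finAdele]_2) (V : set 'cV[finAdele]_2) :
  nbhs x V ->
  \forall y \near x & h \near level_filter (R := R) (F := F), V (uval h *m y).
Proof.
move=> [P xP PV].
have /choice[s sP] : forall i, exists r, radii r /\ fbox (x i 0) r `<=` P i 0.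
  by move=> i; have [r rr rP] := fbox_nbhs (xP i 0); exists r.
pose r v := Num.min (s 0 v) (s 1 v).
have rr : radii r by apply: radii_min; [exact: (sP 0).1|exact: (sP 1).1].
have rs i v : r v <= s i v.
  by elim/ord2_ind: i; rewrite /r ge_min lexx ?orbT.
(* [M v] bounds the entries of [x] and of every [y] in the box around [x]; including [r v] keeps it
   positive, so that [r v / M v] is a valid level at the places of [S]. *)
pose M v := Num.max (r v) (Num.max (cabs (x 0 0 v)) (cabs (x 1 0 v))).
have rM v : r v <= M v by rewrite le_max lexx.
have M0 v : 0 < M v by rewrite (lt_le_trans (rr.1 v)).
have xM i v : cabs (x i 0 v) <= M v.
  by elim/ord2_ind: i; rewrite !le_max lexx !orbT.
pose S := [set v | r v <> 1] `|` \bigcup_i [set v | 1 < cabs (x i 0 v)].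
have Sf : finite_set S.
  rewrite finite_setU; split; first exact: rr.2.
  by apply: bigcup_finite => // i _; exact: fcompP.
have MS v : ~ S v -> r v = 1 /\ M v = 1.
  move=> /not_orP[/contrapT rv xv]; split=> //.
  have x1 i : cabs (x i 0 v) <= 1.
    by rewrite leNgt; apply/negP => ?; apply: xv; exists i.
  by apply/eqP; rewrite eq_le /M rv !ge_max lexx !x1 le_max lexx.
near=> y h => /=.
have yx : forall i, fbox (x i 0) r (y i 0) by near: y; exists
  (fun i j => fbox (x i j) r) => [i j|? ? i]; [exact: nbhs_fbox|].
have Oh : GL2_Ohat h.
  by near: h; exists GL2_Ohat => //; exact: level_group_Ohat.
have hS : forall v, S v -> congruence v (r v / M v) h.
  near: h; apply: near_congruences => // v.
  by rewrite divr_gt0// rr.1.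
apply: PV => i j; rewrite (ord1 j) => {j}; apply: (sP i).2 => v.
apply: le_trans (rs i v).
have yM : mx_le (fmx v y) (M v).
  move=> k j; rewrite (ord1 j) mxE -[fcoord _ _](subrK (x k 0 v)).
  by rewrite (le_trans (cabs_ultra _ _))// ge_max xM (le_trans (yx k v)).
have yr : mx_le (fmx v (y - x)) (r v).
  by move=> k j; rewrite (ord1 j) !mxE; exact: yx.
suff : mx_le (fmx v (uval h *m y - x)) (r v).
  by move=> /(_ i 0); rewrite [X in cabs X]mxE [X in fcoord v X]mxE [X in _ + X]mxE.
have [Sv|nSv] := pselect (S v).
  have [_ h1] := hS v Sv.
  (* Since [h y - x = (h - 1) y + (y - x)], the first term is at most [r v / M v * M v]. *)
  have -> : fmx v (uval h *m y - x) =
      (fmx v (uval h) - 1%:M) *m fmx v y + fmx v (y - x).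
    by rewrite /fmx !map_mxB map_mxM mulmxBl mul1mx addrA subrK.
  apply: mx_leD => //; rewrite -[r v](divfK (lt0r_neq0 (M0 v))).
  by apply: mx_leM => //; rewrite ?divr_ge0// ?ltW// rr.1.
have [rv Mv] := MS v nSv; rewrite rv.
rewrite /fmx map_mxB; apply: mx_leD; last first.
  apply: mx_leN => k j; rewrite (ord1 j) mxE -[leRHS]Mv; exact: xM.
rewrite map_mxM -[1]mulr1; apply: mx_leM => //; first exact: GL2_Ohat_le1.
by rewrite -Mv.
Unshelve. all: by end_near. Qed.

(** Compactness gives invariance only at points of the support. The group property extends it: if
    [g y = 0] but [g (h y) != 0], invariance under [h^-1] at the point [h y] gives a
    contradiction. *)
Lemma bruhat_level_invariant (g : 'cV[finAdele]_2 -> R[i]) : bruhat g ->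
  \forall h \near level_filter (R := R) (F := F),
    forall y, g (uval h *m y) = g y.
Proof.
move=> [gloc gcpt].
have [K [Ksub KO Kfin] KP] : \forall h \near level_filter (R := R) (F := F),
    closure [set x | g x != 0] `<=` [set y | g (uval h *m y) = g y].
  move/compact_near_coveringP : gcpt; apply => x _.
  have gx := gloc x.
  have gy : \forall y \near x & h \near level_filter (R := R) (F := F), g y = g x.
    by exists ([set y | g y = g x], setT); [split=> //; exact: filterT|move=> ? []].
  by apply: filterS2 gy (nbhs_level_action gx) => -[y h] /= -> ->.
have [K1 KM KV] := Ksub.
have inv h y : K h -> g y != 0 -> g (uval h *m y) = g y.
  by move=> Kh gy; apply: (KP h Kh); exact: subset_closure.
exists K => // h Kh y; have [gy|gy] := eqVneq (g y) 0; last exact: inv.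
have [hy|hy] := eqVneq (g (uval h *m y)) 0; first by rewrite hy gy.
rewrite -(inv _ _ (KV _ Kh) hy) mulmxA -[uval h^-1%g *m _]/(uinv h * uval h).
by rewrite uinvK mul1mx.
Qed.

End FiniteAdeleTopology.

(** * Invariance of the Eisenstein series *)

Section EisensteinInvariance.
Variables (R : realType) (F : fieldExtType rat).
Local Notation adele := (adele R F).
Local Notation finAdele := (finAdele R F).
Local Notation GL2 := (GL2 R F).
Local Notation GL2f := (GL2f R F).
Local Notation GL2_Ohat := (@GL2_Ohat R F).

Lemma fst_fin_mx (h : 'M[finAdele]_2) : map_mx fst (fin_mx h) = 1%:M.
Proof. by apply/matrixP => i j; rewrite !mxE. Qed.

Lemma snd_fin_mx (h : 'M[finAdele]_2) : map_mx snd (fin_mx h) = h.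
Proof. by apply/matrixP => i j; rewrite !mxE. Qed.

(** Archimedean coordinates are fixed, so only the finitely many finite factors of the tensors
    impose conditions. *)
Lemma schwartz_bruhat_level_invariant (phi : 'cV[adele]_2 -> R[i]) :
  schwartz_bruhat phi -> \forall h \near level_filter (R := R) (F := F),
    forall y, phi (fin_mx (uval h) *m y) = phi y.
Proof.
move=> [n [f [g [_ gB phiE]]]].
have : \forall h \near level_filter (R := R) (F := F),
    forall i y, g i (uval h *m y) = g i y.
  by apply: filter_forall => i; exact: bruhat_level_invariant.
apply: filterS => h gh y; rewrite !phiE; apply: eq_bigr => i _.
by rewrite !map_mxM fst_fin_mx snd_fin_mx mul1mx gh.
Qed.

Lemma cabs_det_Ohat_le1 (h : GL2f) v : GL2_Ohat h -> cabs ((\det (uval h)) v) <= 1.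
Proof.
move=> Oh; rewrite -[fcomp _ v]/(fcoord v (\det (uval h))) -det_map_mx.
exact: mx_le_det (GL2_Ohat_le1 v Oh).
Qed.

(** The determinants of [h] and of its inverse are both integral at [v] and have product 1. *)
Lemma cabs_det_Ohat (h : GL2f) v : GL2_Ohat h -> cabs ((\det (uval h)) v) = 1.
Proof.
move=> Oh; have [_ _ /(_ h Oh) OhV] := GL2_Ohat_subgroup R F.
have := cabs_det_Ohat_le1 v Oh; have := cabs_det_Ohat_le1 v OhV.
have : cabs ((\det (uval h)) v) * cabs ((\det (uval h^-1%g)) v) = 1.
  rewrite -cabsM -[_ * _]/((\det (uval h) * \det (uval h^-1%g)) v) -det_mulmx.
  rewrite -[uval h *m _]/(uval h * uinv h) uvalK det1.
  by rewrite -[(1 : finAdele) v]/(1 : completion v) cabs1.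
move: (cabs_ge0 ((\det (uval h)) v)) (cabs_ge0 ((\det (uval h^-1%g)) v)).
nra.
Qed.

Lemma idnorm_det_Ohat (g : GL2) (h : GL2f) : GL2_Ohat h ->
  idnorm (\det (uval (g * fin_GL2 h)%g)) = idnorm (\det (uval g)).
Proof.
move=> Oh; rewrite -[uval (g * _)%g]/(uval g *m fin_mx (uval h)) det_mulmx.
set d := \det (fin_mx _); rewrite /idnorm.
have d1 : d.1 = 1 by rewrite -[d.1]/(fst d) -det_map_mx fst_fin_mx det1.
have d2 : d.2 = \det (uval h) by rewrite -[d.2]/(snd d) -det_map_mx snd_fin_mx.
congr (_ * _).
  by apply: eq_fsbigr => s _; rewrite -[(_ * d).1]/(_ * d.1) d1 mulr1.
apply: eq_fsbigr => v _; rewrite -[(_ * d).2 v]/((\det (uval g)).2 v * d.2 v).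
by rewrite cabsM d2 cabs_det_Ohat// mulr1.
Qed.

Lemma Theta_level_invariant (phi : 'cV[adele]_2 -> R[i]) (h : GL2f) (g : GL2) :
  (forall y, phi (fin_mx (uinv h) *m y) = phi y) ->
  Theta phi (g * fin_GL2 h)%g = Theta phi g.
Proof.
move=> phih; rewrite /Theta.
suff -> : (fun y => phi (uinv (g * fin_GL2 h)%g *m y)) = (fun y => phi (uinv g *m y)).
  by [].
apply/funext => y.
by rewrite -[uinv (g * _)%g]/(fin_mx (uinv h) *m uinv g) -mulmxA phih.
Qed.

(** The scalar [t^-1] multiplies on the left and [h] on the right, so by associativity the
    integrands agree at every class. *)
Lemma eisenstein_level_invariant nu omega (phi : 'cV[adele]_2 -> R[i]) (h : GL2f) :
  GL2_Ohat h -> (forall y, phi (fin_mx (uinv h) *m y) = phi y) ->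
  forall g s, eisenstein nu omega phi (g * fin_GL2 h)%g s =
              eisenstein nu omega phi g s.
Proof.
move=> Oh phih g s; rewrite /eisenstein (idnorm_det_Ohat g Oh).
suff E : (fun c => Theta phi ((scalar_GL2 (repr (c : idele_class R F)))^-1 *
                              (g * fin_GL2 h))%g) =
         (fun c => Theta phi ((scalar_GL2 (repr c))^-1 * g)%g).
  exact: (congr1 (fun f => cpow (idnorm (\det (uval g))) (- s) *
    cintegral nu (fun c => omega (repr c) *
      cpow (idnorm (uval (repr (c : idele_class R F)))) (2 * s) * f c)) E).
by apply/funext => c; rewrite mulgA Theta_level_invariant.
Qed.

End EisensteinInvariance.

(** * The identity theorem for meromorphic functions *)

Section PowerSeries.
Variable K : numFieldType.
Implicit Types (a b : nat -> K) (S T : K -> K) (r w e : K).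

Definition psum a w n := \sum_(0 <= k < n) a k * w ^+ k.

(** Convergence of the power series to [S] on a disc, in epsilon form; [r] and [e] are taken in [K]
    itself, where being positive entails being real. *)
Definition pseries_on r a S := forall w, `|w| < r -> forall e, 0 < e ->
  exists N, forall n, (N <= n)%N -> `|S w - psum a w n| < e.

(** Replaces a minimum: the order of [K] is partial, but positive elements are real and hence
    comparable. *)
Lemma common_lower_bound (x y : K) : 0 < x -> 0 < y ->
  exists d, [/\ 0 < d, d <= x & d <= y].
Proof.
move=> x0 y0; have [xy|yx] := real_leP (gtr0_real x0) (gtr0_real y0).
  by exists x; split.
by exists y; split=> //; exact: ltW.
Qed.

Lemma cross_mul_sub (p q x y : K) : p != 0 -> q != 0 ->
  q * x - p * y = p * q * (p^-1 * x - q^-1 * y).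
Proof. by move=> p0 q0; field; rewrite ?p0 ?q0. Qed.

Lemma psumS a w n : psum a w n.+1 = psum a w n + a n * w ^+ n.
Proof. by rewrite /psum big_nat_recr. Qed.

Lemma pseries_on_le r r' a S : r' <= r -> pseries_on r a S -> pseries_on r' a S.
Proof. by move=> rr' aS w wr; apply: aS; exact: lt_le_trans wr rr'. Qed.

Lemma pseries_onB r a b S T : pseries_on r a S -> pseries_on r b T ->
  pseries_on r (fun k => a k - b k) (fun w => S w - T w).
Proof.
move=> aS bT w wr e e0; have e20 : 0 < e / 2 by rewrite divr_gt0.
have [N aN] := aS w wr _ e20; have [M bM] := bT w wr _ e20.
exists (maxn N M) => n; rewrite geq_max => /andP[Nn Mn].
have -> : psum (fun k => a k - b k) w n = psum a w n - psum b w n.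
  by rewrite /psum -sumrB; apply: eq_bigr => k _; rewrite mulrBl.
have -> : S w - T w - (psum a w n - psum b w n) =
    (S w - psum a w n) - (T w - psum b w n) by ring.
by rewrite (le_lt_trans (ler_normB _ _))// [ltRHS]splitr ltrD ?aN ?bM.
Qed.

Lemma pseries_onX r a S n : pseries_on r a S ->
  pseries_on r (fun k => if (k < n)%N then 0 else a (k - n)%N) (fun w => w ^+ n * S w).
Proof.
move=> aS w wr e e0.
(* Adding 1 avoids a division by zero when [w ^+ n = 0]. *)
have w0 : 0 < `|w ^+ n| + 1 by rewrite ltr_wpDl.
have [N aN] := aS w wr _ (divr_gt0 e0 w0).
exists (N + n)%N => m; rewrite addnC => Nm.
have -> : psum (fun k => if (k < n)%N then 0 else a (k - n)%N) w m =
    w ^+ n * psum a w (m - n)%N.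
  rewrite /psum (big_cat_nat (leq0n n)); last by rewrite (leq_trans _ Nm)// leq_addr.
  rewrite /= big_nat_cond big1 ?add0r => [|k /andP[/andP[_ kn] _]]; last first.
    by rewrite kn mul0r.
  rewrite mulr_sumr -{1}[n]add0n big_addn; apply: eq_bigr => k _.
  by rewrite ltnNge leq_addl /= addnK exprD; ring.
rewrite -mulrBr normrM.
have Nmn : (N <= m - n)%N by rewrite leq_subRL// (leq_trans _ Nm)// leq_addr.
rewrite (le_lt_trans _ (_ : (`|w ^+ n| + 1) * `|S w - psum a w (m - n)| < e))//.
  by rewrite ler_wpM2r// lerDl.
by rewrite mulrC -ltr_pdivlMr// aN.
Qed.

(** At a point inside the disc, late terms are differences of consecutive partial sums, each within
    1 of the limit; the finitely many others are bounded by the sum of their norms. *)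
Lemma pseries_coef_bound r a S : 0 < r -> pseries_on r a S ->
  exists rho M, [/\ 0 < rho, 0 < M & forall k, `|a k * rho ^+ k| <= M].
Proof.
move=> r0 aS; pose rho := r / 2.
have rho0 : 0 < rho by rewrite divr_gt0.
have rhor : `|rho| < r by rewrite gtr0_norm// ltr_pdivrMr// ltr_pMr// ltr1n.
have [N aN] := aS rho rhor 1 ltr01.
have sum0 n : 0 <= \sum_(0 <= k < n) `|a k * rho ^+ k| by apply: sumr_ge0.
exists rho, (2 + \sum_(0 <= k < N) `|a k * rho ^+ k|); split=> // [|k].
  by rewrite ltr_wpDr.
have [kN|Nk] := ltnP k N; last first.
  apply: (@le_trans _ _ 2); last by rewrite lerDl.
  have -> : a k * rho ^+ k = (S rho - psum a rho k) - (S rho - psum a rho k.+1).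
    by rewrite psumS; ring.
  rewrite (le_trans (ler_normB _ _))// [leRHS](_ : _ = 1 + 1)//.
  by rewrite lerD// ltW// aN// leqW.
apply: (@le_trans _ _ (\sum_(0 <= j < N) `|a j * rho ^+ j|)); last by rewrite lerDr.
rewrite (bigD1_seq k) ?iota_uniq//= ?mem_index_iota// lerDl.
by apply: sumr_ge0.
Qed.

Lemma pseries_lead_term r a S n : 0 < r -> pseries_on r a S ->
  (forall k, (k < n)%N -> a k = 0) ->
  exists d B, [/\ 0 < d, 0 < B & forall w, 0 < `|w| < d ->
    `|S w - a n * w ^+ n| <= B * `|w| ^+ n.+1].
Proof.
move=> r0 aS a0; have [rho [M [rho0 M0 aM]]] := pseries_coef_bound r0 aS.
have [d [d0 dr drho]] := common_lower_bound r0 (divr_gt0 rho0 (@ltr0Sn K 1)).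
(* With [t] at most 1/2 below, the geometric tail contributes 2 and the distance from a partial sum
   to [S w] contributes 1. *)
exists d, (3 * M / rho ^+ n.+1); split=> //.
  by rewrite !divr_gt0 ?mulr_gt0 ?exprn_gt0.
move=> w /andP[w0 wd]; have wr := lt_le_trans wd dr.
have wrho := lt_le_trans wd drho.
pose t := `|w| / rho.
have t0 : 0 < t by rewrite divr_gt0.
have t2 : 2 * t <= 1.
  by rewrite mulrA ler_pdivrMr// mul1r mulrC -ler_pdivlMr// ltW.
have term k : `|a k * w ^+ k| <= M * t ^+ k.
  rewrite expr_div_n mulrA ler_pdivlMr ?exprn_gt0// normrM normrX mulrAC.
  by rewrite ler_wpM2r ?exprn_ge0// -(gtr0_norm (exprn_gt0 k rho0)) -normrM.
(* The subtracted term makes the induction close: [t ^+ k <= 2 * t ^+ k - 2 * t ^+ k.+1] when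
   [2 * t <= 1]. *)
have part j : `|psum a w (n.+1 + j) - a n * w ^+ n| <=
    M * (2 * t ^+ n.+1 - 2 * t ^+ (n.+1 + j)).
  elim: j => [|j IH].
    rewrite addn0 subrr mulr0 psumS addrK /psum big_nat_cond big1 ?normr0//.
    by move=> k /andP[/andP[_ kn] _]; rewrite a0// mul0r.
  rewrite addnS psumS addrAC (le_trans (ler_normD _ _))//.
  apply: (le_trans (lerD IH (term _))); rewrite -mulrDr ler_wpM2l ?(ltW M0)//.
  rewrite -subr_ge0 [t ^+ (n.+1 + j).+1]exprS.
  rewrite (_ : _ - _ = (1 - 2 * t) * t ^+ (n.+1 + j)); last by ring.
  by rewrite mulr_ge0 ?subr_ge0// exprn_ge0// ltW.
have e0 : 0 < M * t ^+ n.+1 by rewrite mulr_gt0// exprn_gt0.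
have [N SN] := aS w wr _ e0.
rewrite (_ : S w - _ = (S w - psum a w (n.+1 + N)) + (psum a w (n.+1 + N) - a n * w ^+ n));
  last by ring.
rewrite (le_trans (ler_normD _ _))//.
rewrite (_ : _ * _ = M * t ^+ n.+1 + M * (2 * t ^+ n.+1)); last first.
  by rewrite expr_div_n; field; rewrite expf_neq0// gt_eqF.
rewrite lerD//; first by rewrite ltW// SN// leq_addl.
rewrite (le_trans (part N))// ler_wpM2l ?(ltW M0)// lerBlDr lerDl.
by rewrite mulr_ge0// exprn_ge0// ltW.
Qed.

(** For [w] small and nonzero the leading term [a n * w ^+ n] exceeds the error
    [B * |w| ^+ n.+1]. *)
Lemma pseries_isolated_zero r a S n : 0 < r -> pseries_on r a S ->
  (forall k, (k < n)%N -> a k = 0) -> a n != 0 ->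
  exists2 d, 0 < d & forall w, 0 < `|w| < d -> S w != 0.
Proof.
move=> r0 aS a0 an0; have [d [B [d0 B0 dB]]] := pseries_lead_term r0 aS a0.
have aB : 0 < `|a n| / B by rewrite divr_gt0// normr_gt0.
have [c [c0 cd cB]] := common_lower_bound d0 aB.
exists c => // w /andP[w0 wc]; have wd := lt_le_trans wc cd.
have wB := lt_le_trans wc cB; apply/eqP => Sw.
have := dB w; rewrite w0 wd Sw sub0r normrN normrM normrX => /(_ isT).
rewrite exprS mulrA ler_pM2r ?exprn_gt0//.
have Bw : B * `|w| < `|a n| by rewrite mulrC -ltr_pdivlMr.
by move=> /le_lt_trans /(_ Bw); rewrite ltxx.
Qed.

Lemma pseries_zero r a S : pseries_on r a S -> (forall k, a k = 0) ->
  forall w, `|w| < r -> S w = 0.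
Proof.
move=> aS a0 w wr; apply/eqP/contraT; rewrite -normr_gt0 => Sw.
have [N /(_ N (leqnn N))] := aS w wr _ Sw.
by rewrite /psum big1 ?subr0 ?ltxx// => k _; rewrite a0 mul0r.
Qed.

Lemma pseries_dichotomy r a S : 0 < r -> pseries_on r a S ->
  exists2 d, 0 < d & (forall w, 0 < `|w| < d -> S w = 0) \/
                     (forall w, 0 < `|w| < d -> S w != 0).
Proof.
move=> r0 aS; have [a0|/existsNP[k0 /eqP ak0]] := pselect (forall k, a k = 0).
  by exists r => //; left=> w /andP[_]; exact: pseries_zero aS a0 w.
have ex : exists k, a k != 0 by exists k0.
have [n an nmin] := ex_minnP ex.
have [|d d0 dS] := pseries_isolated_zero r0 aS (n := n) _ an.
  move=> k kn; apply/eqP; apply: contraTT kn => /nmin; by rewrite -leqNgt.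
by exists d => //; right.
Qed.

End PowerSeries.

(** * Comparison of two meromorphic functions, locally and globally *)

Section MeromorphicIdentity.
Variable R : realType.
Local Notation C := R[i].
Implicit Types (f g : C -> option C) (z : C).

Lemma meromorphic_pseries f z0 : meromorphic f -> exists m a S r,
  [/\ 0 < r, pseries_on r a S,
      forall z, 0 < `|z - z0| < r -> f z = Some ((z - z0) ^- m * S (z - z0)),
      m = 0%N -> f z0 = Some (a 0%N)
    & (0 < m)%N -> a 0%N != 0 /\ f z0 = None].
Proof.
move=> /(_ z0)[m [a [S [r [r0 aS fS f0 foo]]]]].
exists m, a, S, (r%:C)%C; split=> //; first by rewrite ltcR.
by move=> w wr e e0; have /cvgrPdist_lt/(_ e e0)[N _ SN] := aS w wr; exists N.
Qed.

Definition punctured_near z0 (P : C -> Prop) :=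
  exists2 d : C, 0 < d & forall z, 0 < `|z - z0| < d -> P z.

(** Multiplying the difference of the two Laurent expansions by [w ^+ m * w ^+ n] clears the poles
    and leaves a power series with the same zeros off [z0]. The last clauses keep what is needed to
    compare the values at [z0]. *)
Lemma meromorphic_difference f g z0 : meromorphic f -> meromorphic g ->
  exists m n a b S T r, [/\ 0 < r,
    pseries_on r (fun k => (if (k < n)%N then 0 else a (k - n)%N) -
                           (if (k < m)%N then 0 else b (k - m)%N))
      (fun w => w ^+ n * S w - w ^+ m * T w),
    forall z, 0 < `|z - z0| < r -> (f z = g z <->
      (z - z0) ^+ n * S (z - z0) - (z - z0) ^+ m * T (z - z0) = 0),
    if m is 0%N then f z0 = Some (a 0%N) else a 0%N != 0 /\ f z0 = None &
    if n is 0%N then g z0 = Some (b 0%N) else b 0%N != 0 /\ g z0 = None].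
Proof.
move=> /(meromorphic_pseries z0)[m [a [S [r [r0 aS fS f0 foo]]]]].
move=> /(meromorphic_pseries z0)[n [b [T [s [s0 bT gT g0 goo]]]]].
have [d [d0 dr ds]] := common_lower_bound r0 s0.
exists m, n, a, b, S, T, d; split=> //.
- apply: pseries_onB; apply: pseries_onX; first exact: pseries_on_le aS.
  exact: pseries_on_le bT.
- move=> z /andP[z0z zd]; rewrite fS ?z0z ?(lt_le_trans zd)//.
  rewrite gT ?z0z ?(lt_le_trans zd)//.
  have w0 : z - z0 != 0 by rewrite -normr_gt0.
  have wm := expf_neq0 m w0; have wn := expf_neq0 n w0.
  set x := S _; set y := T _.
  rewrite (cross_mul_sub _ _ wm wn); split=> [[->]|/eqP]; first by rewrite subrr mulr0.
  by rewrite !mulf_eq0 (negbTE wm) (negbTE wn) subr_eq0 => /eqP ->.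
- by case: m {aS fS} f0 foo => [/(_ erefl)//|m _ /(_ isT)].
- by case: n {bT gT} g0 goo => [/(_ erefl)//|n _ /(_ isT)].
Qed.

Lemma meromorphic_dichotomy f g z0 : meromorphic f -> meromorphic g ->
  punctured_near z0 (fun z => f z = g z) \/ punctured_near z0 (fun z => f z <> g z).
Proof.
move=> fm gm; have [m [n [a [b [S [T [r [r0 D fg _ _]]]]]]]] :=
  meromorphic_difference z0 fm gm.
have [d d0 DS] := pseries_dichotomy r0 D.
have [e [e0 er ed]] := common_lower_bound r0 d0.
have rd z : 0 < `|z - z0| < e -> (0 < `|z - z0| < r) /\ (0 < `|z - z0| < d).
  by move=> /andP[-> ze]; rewrite !(lt_le_trans ze).
case: DS => DS; [left|right]; exists e => // z /rd[zr zd].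
- by apply/(fg z zr); exact: DS.
- by move=> /(fg z zr)/eqP; apply/negP; exact: DS.
Qed.

(** The constant coefficient of the cleared difference must vanish. This excludes a pole of only one
    of the functions; two finite values then agree, and two poles both have value [None]. *)
Lemma punctured_near_value f g z0 : meromorphic f -> meromorphic g ->
  punctured_near z0 (fun z => f z = g z) -> f z0 = g z0.
Proof.
move=> fm gm [d d0 fgd]; have [m [n [a [b [S [T [r [r0 D fg f0 g0]]]]]]]] :=
  meromorphic_difference z0 fm gm.
suff D0 : (if (0 < n)%N then 0 else a 0%N) - (if (0 < m)%N then 0 else b 0%N) = 0.
  case: m n f0 g0 D0 {D fg} => [|m] [|n] /=; rewrite ?sub0r ?subr0.
  - by move=> -> -> /eqP; rewrite subr_eq0 => /eqP ->.
  - by move=> _ [b0 _] /eqP; rewrite oppr_eq0 (negbTE b0).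
  - by move=> [a0 _] _ /eqP; rewrite (negbTE a0).
  - by move=> [_ ->] [_ ->].
apply/eqP/contraT => ab.
have [//|c c0 Dc] := pseries_isolated_zero (n := 0%N) r0 D _ ab.
have [e [e0 er ed]] := common_lower_bound r0 d0.
have [h [h0 hc he]] := common_lower_bound c0 e0.
(* [z0 + h / 2] lies in both punctured discs, where the cleared difference is at once zero and
   nonzero. *)
have h2 : 0 < h / 2 by rewrite divr_gt0.
have h2h : h / 2 < h by rewrite ltr_pdivrMr// ltr_pMr// ltr1n.
have zE : z0 + h / 2 - z0 = h / 2 by rewrite addrC addKr.
have := Dc (h / 2); rewrite gtr0_norm// h2 (lt_le_trans h2h)// => /(_ isT).
have := fg (z0 + h / 2); have := fgd (z0 + h / 2).
rewrite zE gtr0_norm// h2 !(lt_le_trans h2h) ?(le_trans he)// => /(_ isT) E /(_ isT).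
by case=> /(_ E) -> _; rewrite eqxx.
Qed.

(* By the dichotomy, the set of points with f = g on a punctured neighbourhood is
   clopen; it is pulled back to the line through x0 + 1 and z. *)
Lemma meromorphic_identity f g (x0 : R) : meromorphic f -> meromorphic g ->
  (forall s, x0 < complex.Re s -> f s = g s) -> f = g.
Proof.
move=> fm gm fg; apply/funext => z; apply: punctured_near_value => //.
pose near_eq (z : C) := punctured_near z (fun z => f z = g z).
have open_near (P : C -> Prop) z1 : punctured_near z1 P ->
    exists2 d : C, 0 < d & forall z2, `|z2 - z1| < d -> punctured_near z2 P.
  move=> [d d0 dP]; exists d => // z2; have [->|z21] := eqVneq z2 z1.
    by exists d.
  move=> z2d; have z20 : 0 < `|z2 - z1| by rewrite normr_gt0 subr_eq0.
  have z2d' : 0 < d - `|z2 - z1| by rewrite subr_gt0.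
  (* A disc around [z2] of this radius avoids the centre [z1] and stays inside the disc of radius
     [d]. *)
  have [e [e0 e1 e2]] := common_lower_bound z20 z2d'.
  exists e => // z3 /andP[_ z3e]; apply: dP; apply/andP; split.
    rewrite normr_gt0 subr_eq0; apply: contraTneq z3e => ->; apply/negP.
    by rewrite distrC => /lt_le_trans/(_ e1); rewrite ltxx.
  rewrite -(subrK z2 z3) -addrA (le_lt_trans (ler_normD _ _))//.
  by rewrite -ltrBrDr (lt_le_trans z3e).
pose p (t : R) : C := (x0 + 1)%:C%C + t%:C%C * (z - (x0 + 1)%:C%C).
pose A := [set t : R | near_eq (p t)].
have A0 : A 0.
  (* The unit disc around [x0 + 1] lies in the half-plane where [f] and [g] agree. *)
  rewrite /A /= /p mul0r addr0; exists 1 => // s /andP[_ s1]; apply: fg.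
  have := le_lt_trans (normc_ge_Re _) s1.
  rewrite -(rmorph1 (real_complex R)) ltcR raddfB/= ltr_norml => /andP[+ _]; lra.
have p_open (P : C -> Prop) : open [set t : R | punctured_near (p t) P].
  rewrite openE => t /= /open_near[d d0 dP].
  (* A positive Lipschitz constant for [p], even when [z = x0 + 1]. *)
  pose c := `|z - (x0 + 1)%:C%C| + 1.
  have c0 : 0 < c by rewrite ltr_wpDl.
  have : 0 < d / c by rewrite divr_gt0.
  have dcR : d / c \is Num.real by rewrite gtr0_real ?divr_gt0.
  rewrite -(RRe_real dcR) -(rmorph0 (real_complex R)) ltcR => e0.
  exists (complex.Re (d / c)) => //= u; rewrite /ball/= => tu; apply: dP.
  have -> : p u - p t = (u - t)%:C%C * (z - (x0 + 1)%:C%C).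
    by rewrite /p rmorphB; ring.
  rewrite normrM; apply: (@le_lt_trans _ _ (`|(u - t)%:C%C| * c)).
    by rewrite ler_wpM2l// lerDl.
  rewrite -ltr_pdivlMr// -(RRe_real dcR) normc_def/= expr0n/= addr0 sqrtr_sqr ltcR.
  by rewrite distrC.
have Ao : open A by exact: p_open.
have Ac : closed A.
  rewrite -openC (_ : ~` A = [set t : R | punctured_near (p t) (fun z => f z <> g z)]).
    exact: p_open.
  apply/seteqP; split=> t /=.
    by case: (meromorphic_dichotomy (p t) fm gm).
  (* The two alternatives exclude each other, because any two punctured discs around [p t] share a
     point. *)
  move=> [d d0 dP] [e e0 eP]; have [h [h0 hd he]] := common_lower_bound d0 e0.
  have h2 : 0 < h / 2 by rewrite divr_gt0.
  have h2h : h / 2 < h by rewrite ltr_pdivrMr// ltr_pMr// ltr1n.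
  have zE : p t + h / 2 - p t = h / 2 by rewrite addrC addKr.
  by apply: (dP (p t + h / 2)); [|apply: eP]; rewrite zE gtr0_norm// h2 (lt_le_trans h2h).
have AT : A = setT.
  have cT : connected [set: R] by apply/connected_intervalP.
  by apply: cT; [exists 0|exists A => //; rewrite setTI|exists A => //; rewrite setTI].
have : A 1 by rewrite AT.
by rewrite /A /= /p mul1r addrC subrK.
Qed.

End MeromorphicIdentity.

(** * Choice of the level group and comparison of the continuations *)

Unset Implicit Arguments.

Theorem mainTheorem7 (R : realType) (F : fieldExtType rat)
  (F_real : totally_real R F)
  (mu : {measure set (borel_idele R F) -> \bar R}) (mu_haar : haar_measure mu)
  (nu : {measure set (borel_class R F) -> \bar R})
  (nu_quotient : quotient_measure mu nu)
  (omega : idele R F -> R[i]) (omega_hecke : unitary_hecke_character omega)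
  (phi : 'cV[adele R F]_2 -> R[i]) (phi_sb : schwartz_bruhat phi) :
  exists K : set (GL2f R F),
    [/\ is_subgroup K, K `<=` @GL2_Ohat R F, finite_index K (@GL2_Ohat R F)
      & forall h, K h -> forall g : GL2 R F,
          (forall s : R[i], 1 < complex.Re s ->
             eisenstein nu omega phi (g * fin_GL2 h)%g s =
             eisenstein nu omega phi g s) /\
          (forall E E' : R[i] -> option R[i],
             eisenstein_continuation nu omega phi g E ->
             eisenstein_continuation nu omega phi (g * fin_GL2 h)%g E' ->
             E' = E)].
Proof.
have [K [Ksub KO Kfin] Kphi] := schwartz_bruhat_level_invariant phi_sb.
have [_ _ KV] := Ksub.
exists K; split; [exact: Ksub|exact: KO|exact: level_group_finite_index|].
(* The theta series involves [h^-1], so the invariance of [phi] is applied to the inverse, which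
   again lies in [K]. *)
move=> h Kh g; have Eh := eisenstein_level_invariant nu omega (KO h Kh) (Kphi _ (KV h Kh)) g.
split=> [s _|E E' [Em EE] [E'm EE']]; first exact: Eh.
apply: (meromorphic_identity (x0 := 1) E'm Em) => s s1.
by rewrite (EE' s s1) (EE s s1) Eh.
Qed.
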